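(* Let $A \in \mathbb{C}^{N\times N}$ be a positive semidefinite matrix, let $r \ge 1$ be an integer, let $\varepsilon,\delta \in (0,1)$, and let $\widehat{A}^{(k)}$ denote the output of $k$ steps of the randomly pivoted Cholesky algorithm on $A$ (for $k$ a nonnegative integer). Define $$k_{\rm hp}(r,\varepsilon,\delta) := -\frac{r}{\log(1+\varepsilon)}\, W_{-1}\!\left( -\frac{\log(1+\varepsilon)\,\delta^{1/r}}{r(1+\varepsilon)} \right).$$ Then: (a) $\mathbb{E}\bigl[\operatorname{tr}(A - \widehat{A}^{(k)})\bigr] \le (1+\varepsilon)\operatorname{tr}(A - [A]_r)$ whenever $$k \ge \frac{r}{\varepsilon} + 2r\sqrt{\log r} + r\log\left(\frac{1}{\varepsilon}\right) + 2.3\, r.$$ (b) $\mathbb{P}\bigl\{\operatorname{tr}(A - \widehat{A}^{(k)}) > (1+\varepsilon)\operatorname{tr}(A - [A]_r)\bigr\} \le \delta$ whenever $k \ge k_{\rm hp}(r,\varepsilon,\delta)$. Moreover, the function $k_{\rm hp}$ satisfies the bound $$k_{\rm hp}(r,\varepsilon,\delta) \le \frac{4r}{\varepsilon}\log\left(\frac{4r}{\varepsilon}\right) + \frac{4}{\varepsilon}\log\left(\frac{1}{\delta}\right)$$ and the asymptotics $$k_{\rm hp}(r,\varepsilon,\delta) \sim \frac{r}{\varepsilon}\log\left(\frac{r}{\varepsilon}\right) + \frac{1}{\varepsilon}\log\left(\frac{1}{\delta}\right) \quad \text{as } r\to\infty \text{ and } \varepsilon,\delta\downarrow 0,$$ where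 $\sim$ means that the ratio of the two sides tends to $1$.
   Context: A matrix $A\in\mathbb{C}^{N\times N}$ is positive semidefinite (psd) if $A = A^*$ and all its eigenvalues are nonnegative. $[A]_r$ denotes an optimal rank-$r$ approximation to $A$ in any unitarily invariant norm (the truncated eigendecomposition), so that $\operatorname{tr}(A-[A]_r)=\sum_{i>r}\lambda_i(A)$ with eigenvalues $\lambda_1(A)\ge\cdots\ge\lambda_N(A)$. $\log$ is the natural logarithm. $W_{-1}:[-1/e,0)\to(-\infty,-1]$ is the lower real branch of the Lambert $W$ function: $W_{-1}(x)$ is the unique $w\le -1$ with $w e^{w} = x$. Randomly pivoted Cholesky algorithm on $A$: set $\widehat{A}^{(0)} = 0$. At step $i=1,2,\dots$, conditionally on the past, draw a random pivot index $s_i\in\{1,\dots,N\}$ with $$\mathbb{P}\{s_i = t\} = \frac{A(t,t) - \widehat{A}^{(i-1)}(t,t)}{\operatorname{tr}(A - \widehat{A}^{(i-1)})},$$ let $v_i = A(:,s_i) - \widehat{A}^{(i-1)}(:,s_i)$ (the $s_i$-th column of $A-\widehat{A}^{(i-1)}$), and set $\widehat{A}^{(i)} = \widehat{A}^{(i-1)} + v_i v_i^*/v_i(s_i)$. Convention: if $A - \widehat{A}^{(i-1)} = 0$, then $\widehat{A}^{(i)} = \widehat{A}^{(i-1)}$. The output of $k$ steps is $\widehat{A}^{(k)}$. *)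

(* Defs.v *)
From HB Require Import structures.
From mathcomp Require Import all_boot all_order all_algebra.
From mathcomp Require Import all_classical all_reals all_analysis.
From mathcomp Require Import complex.

Set Implicit Arguments.
Unset Strict Implicit.
Unset Printing Implicit Defensive.

Import Order.TTheory GRing.Theory Num.Theory.
Import numFieldNormedType.Exports.

Local Open Scope classical_set_scope.
Local Open Scope ring_scope.
Local Open Scope sesquilinear_scope.

(* The order on R[i] is partial: 0 <= a says that a is real and nonnegative. *)
Definition psdmx (R : realType) (N : nat) (A : 'M[R[i]]_N) : Prop :=
  A = A ^t* /\ forall a : R[i], eigenvalue A a -> 0 <= a.

(* B = [A]_r for some choice of the eigenvectors; when there are ties between
   eigenvalues B need not be unique, but its trace is. *)
Definition truncated_eigendecomposition (R : realType) (N : nat)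
    (A : 'M[R[i]]_N) (r : nat) (B : 'M[R[i]]_N) : Prop :=
  exists (U : 'M[R[i]]_N) (lam : 'I_N -> R),
    [/\ U \is unitarymx,
        forall i j : 'I_N, (i <= j)%N -> lam j <= lam i,
        A = U *m diag_mx (\row_i ((lam i)%:C)%C) *m U ^t* &
        B = U *m diag_mx (\row_i (if (i < r)%N then ((lam i)%:C)%C else 0))
              *m U ^t*].

(* The total division of MathComp makes the update zero when the pivot entry
   vanishes; such a pivot is drawn with probability zero. *)
Definition cholesky_step (R : realType) (N : nat) (A Ahat : 'M[R[i]]_N)
    (t : 'I_N) : 'M[R[i]]_N :=
  if A - Ahat == 0 then Ahat
  else let v := col t (A - Ahat) in
       Ahat + (v t ord0)^-1 *: (v *m v ^t*).

(* Pivots are numbered from 0, so that s i is the pivot of step i + 1. *)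
Fixpoint pivoted_cholesky (R : realType) (N : nat) (A : 'M[R[i]]_N)
    (s : nat -> 'I_N) (k : nat) : 'M[R[i]]_N :=
  if k is k'.+1 then cholesky_step A (pivoted_cholesky A s k') (s k') else 0.

Definition cond_prob (d : measure_display) (T : measurableType d)
    (R : realType) (P : probability T R) (E F : set T) : R :=
  fine (P (E `&` F)) / fine (P F).

Definition past (T : Type) (N : nat) (s : nat -> T -> 'I_N) (i : nat)
    (h : nat -> 'I_N) : set T :=
  [set w | forall j, (j < i)%N -> s j w = h j].

(* The random pivots s 0, ..., s (k - 1) follow the rule of randomly pivoted
   Cholesky. The algorithm stops at a zero residual, so nothing is required of
   the pivots drawn from then on. *)
Definition random_pivots (d : measure_display) (T : measurableType d)
    (R : realType) (P : probability T R) (N : nat) (A : 'M[R[i]]_N) (k : nat)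
    (s : nat -> T -> 'I_N) : Prop :=
  (forall (i : nat) (t : 'I_N), (i < k)%N -> measurable [set w | s i w = t]) /\
  (forall (i : nat) (h : nat -> 'I_N) (t : 'I_N), (i < k)%N ->
     let res := A - pivoted_cholesky A h i in
     P (past s i h) != 0%E -> res != 0 ->
     ((cond_prob P [set w | s i w = t] (past s i h))%:C)%C
       = res t t / \tr res).

Definition rpcholesky (T : Type) (R : realType) (N : nat) (A : 'M[R[i]]_N)
    (s : nat -> T -> 'I_N) (k : nat) (w : T) : 'M[R[i]]_N :=
  pivoted_cholesky A (fun j => s j w) k.

Definition retr (R : realType) (N : nat) (M : 'M[R[i]]_N) : R :=
  complex.Re (\tr M).

(* Meaningful on [-1/e, 0[, where such a w exists and is unique. *)
Definition lambertWm1 (R : realType) (x : R) : R :=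
  xget 0 [set w : R | w <= -1 /\ w * expR w = x].

Definition k_hp (R : realType) (r : nat) (eps delta : R) : R :=
  - (r%:R / ln (1 + eps)) *
    lambertWm1 (- ((ln (1 + eps) * delta `^ (r%:R^-1)) / (r%:R * (1 + eps)))).

(* Main.v *)
Require Import Defs.
From HB Require Import structures.
From mathcomp Require Import all_boot all_order all_algebra.
From mathcomp Require Import all_classical all_reals all_analysis.
From mathcomp Require Import complex.
From mathcomp Require Import measurable_realfun.
From mathcomp Require Import ring lra.

(** Write H for the residual A - Ahat.  One step of the algorithm with pivot t
    replaces H by its Schur complement H - h h^* / H(t,t), where h is column t,
    so everything is about a random walk of Schur complements that chooses t
    with probability H(t,t) / tr H.  Let tau be the sum of the eigenvalues of A
    after the r largest ones, and x_i the trace of the residual after i steps;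
    the eigenvalues lam_0 >= lam_1 >= ... are numbered from 0.

    The key identity is exact: multiplying the transition probabilities by the
    traces leaves the product of the pivots, and that product is a principal
    minor of A.  Hence the mean of x_0 x_1 ... x_k is (k+1)! e_(k+1), with e_m
    the elementary symmetric function of the eigenvalues of A
    ([law_minor_sum], [minor_sumE]).  It comes from the fact that the sum over
    t of H(t,t) det(1 + x H/t), where H/t is the Schur complement, is the
    derivative of det(1 + x H) in x ([deriv_specpoly]).

    Put m = k+1 > r.  From above, m! e_m is at most
    m^r tau^(m-r) times the product of tau + lam_i over the r largest
    eigenvalues lam_i ([minor_sum_le]).  From below, on every path, A minus the
    i-th residual has rank at most i, so Ky Fan's principle gives
    x_i >= lam_i + tau for i < r ([trace_ge_tail]), and the factors x_i with
    i >= r are at least x_k.  The large eigenvalues cancel: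
        E[x_k^(m-r)] <= m^r tau^(m-r)        ([law_moment]).

    Part (b) is Markov's inequality applied to this moment: the failure
    probability is at most m^r (1+eps)^(r-m).  The equation
    k^r (1+eps)^(r-k) = delta is solved by k = k_hp, which is how the Lambert
    function enters ([k_hp_eq]), and its left side decreases from there on
    ([failure_weight_le]).

    Part (a) has two phases.  With a = sqrt(ln r), after about (1+a) r steps
    Jensen's inequality turns the moment bound into E x <= M tau with
    ln M <= 1+a ([exists_burn_in], [mean_trace_moment]).  From then on
    Cauchy-Schwarz gives r tr H^2 >= (tr H - tau)^2 ([trace_sqr_ge]), so
    y = E x - tau decreases at least as y' = y - y^2 / (r (y + tau)).  The
    potential r ln y - r tau / y then loses at least 1 in each step
    ([drift_log]), so r ln M + r ln(1/eps) + r/eps further steps bring y below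
    eps tau.  In total this takes at most
    r/eps + 2 r a + r ln(1/eps) + 2 r steps.

    The two claims about k_hp follow from its equation.  With L = ln(1+eps),
    kappa L = r ln kappa + r L + ln(1/delta); bounding ln kappa by a tangent of
    the logarithm gives both the explicit bound ([k_hp_le]) and a ratio close
    to 1 ([k_hp_ratio_bounds]). *)

Set Implicit Arguments.
Unset Strict Implicit.
Unset Printing Implicit Defensive.

Import Order.TTheory GRing.Theory Num.Theory.
Import numFieldNormedType.Exports.

Local Open Scope ring_scope.
Local Open Scope sesquilinear_scope.

(** * Positive semidefinite matrices and Schur complements *)

Lemma adjmxM (C : numClosedFieldType) m n p (A : 'M[C]_(m, n))
    (B : 'M[C]_(n, p)) : (A *m B)^t* = B^t* *m A^t*.
Proof. by rewrite trmx_mul map_mxM. Qed.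

Lemma adjmxB (C : numClosedFieldType) m n (A B : 'M[C]_(m, n)) :
  (A - B)^t* = A^t* - B^t*.
Proof. by apply/matrixP => i j; rewrite !mxE rmorphB. Qed.

Lemma adjmxZ (C : numClosedFieldType) m n (a : C) (A : 'M[C]_(m, n)) :
  (a *: A)^t* = (a^*)%R *: A^t*.
Proof. by apply/matrixP => i j; rewrite !mxE rmorphM. Qed.

Lemma ge0_ReE (R : realType) (x : R[i]) :
  0 <= x -> x = ((complex.Re x)%:C)%C /\ 0 <= complex.Re x.
Proof. by case: x => a b; rewrite lecE /= => /andP[/eqP -> ->]. Qed.

Lemma conj_realC (R : realType) (x : R) : (((x%:C)%C : R[i])^*)%R = (x%:C)%C.
Proof. by apply/eqP; rewrite eq_complex /= oppr0 !eqxx. Qed.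

(** Both sides are the determinant of the bordered matrix with blocks 1, v, u, 1,
    eliminated from its two corners. *)
Lemma det_1B_rank1 (F : comPzRingType) n (u : 'cV[F]_n) (v : 'rV[F]_n) :
  \det (1%:M - u *m v) = 1 - (v *m u) 0 0.
Proof.
have e1 : block_mx 1%:M v u 1%:M =
    block_mx 1%:M 0 u 1%:M *m block_mx (1%:M : 'M[F]_1) v 0 (1%:M - u *m v).
  by rewrite mulmx_block !mul0mx !mulmx0 !mul1mx !mulmx1 !addr0 addrC subrK.
have e2 : block_mx 1%:M v u 1%:M =
    block_mx ((1%:M : 'M[F]_1) - v *m u) v 0 1%:M *m block_mx 1%:M 0 u 1%:M.
  by rewrite mulmx_block !mul0mx !mulmx0 !mulmx1 !mul1mx !add0r subrK.
have := congr1 (@determinant _ _) e1.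
rewrite e2 !det_mulmx !det_lblock !det_ublock !det1 !mulr1 !mul1r => <-.
by rewrite det_mx11 !mxE.
Qed.

Section Psd.
Variables (R : realType) (N : nat).
Local Notation C := (R[i]).
Let evec t : 'cV[C]_N := delta_mx t 0.
Implicit Types (H U : 'M[C]_N) (lam : 'I_N -> R).

(** Quadratic forms, unlike eigenvalues, make stability under sums, congruences
    and Schur complements immediate. *)
Definition psd_form H :=
  H = H^t* /\ forall v : 'cV[C]_N, 0 <= (v^t* *m H *m v) 0 0.

Definition from_spectrum U lam : 'M[C]_N :=
  U *m diag_mx (\row_i ((lam i)%:C)%C) *m U^t*.

(** The residual after one more pivot.  A zero pivot leaves H unchanged because
    the inverse of 0 is 0. *)
Definition schur_step H (t : 'I_N) : 'M[C]_N :=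
  H - (H t t)^-1 *: (col t H *m (col t H)^t*).

Lemma quad_diagE (d : 'rV[C]_N) (w : 'cV[C]_N) :
  (w^t* *m diag_mx d *m w) 0 0 = \sum_l d 0 l * `|w l 0| ^+ 2.
Proof.
rewrite mul_mx_diag !mxE; apply: eq_bigr => l _; rewrite !mxE normCK.
by rewrite mulrC [X in _ * X]mulrC mulrCA.
Qed.

Lemma quad_spectrumE U lam (v : 'cV[C]_N) :
  (v^t* *m from_spectrum U lam *m v) 0 0
    = \sum_l ((lam l)%:C)%C * `|(U^t* *m v) l 0| ^+ 2.
Proof.
have -> : v^t* *m from_spectrum U lam *m v =
    (U^t* *m v)^t* *m diag_mx (\row_i ((lam i)%:C)%C) *m (U^t* *m v).
  by rewrite adjmxM trmxCK /from_spectrum !mulmxA.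
by rewrite quad_diagE; apply: eq_bigr => l _; rewrite mxE.
Qed.

Lemma from_spectrum_herm U lam : from_spectrum U lam = (from_spectrum U lam)^t*.
Proof.
rewrite /from_spectrum !adjmxM trmxCK -mulmxA; congr (_ *m (_ *m _)).
rewrite tr_diag_mx map_diag_mx; congr diag_mx; apply/rowP => i.
by rewrite !mxE; apply: esym; apply: conj_realC.
Qed.

Lemma from_spectrum_psd U lam :
  (forall i, 0 <= lam i) -> psd_form (from_spectrum U lam).
Proof.
move=> lam0; split; first exact: from_spectrum_herm.
move=> v; rewrite quad_spectrumE sumr_ge0 // => l _.
by rewrite mulr_ge0 ?exprn_ge0 // lecR.
Qed.

Lemma delta_quadE H (t : 'I_N) :
  ((evec t)^t* *m H *m (evec t)) 0 0 = H t t.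
Proof.
rewrite /evec trmx_delta map_delta_mx -rowE -colE.
by rewrite !mxE.
Qed.

Lemma psd_diag_ge0 H t : psd_form H -> 0 <= H t t.
Proof. by move=> [_ /(_ (evec t))]; rewrite delta_quadE. Qed.

Lemma psd_spectrum H : psd_form H ->
  exists U lam, [/\ U \is unitarymx, forall i, 0 <= lam i
    & H = from_spectrum U lam].
Proof.
move=> [Hh Hq].
have /orthomx_spectralP : H \is normalmx by apply/normalmxP; rewrite -Hh.
have PU := spectral_unitarymx H.
set P := spectralmx H in PU *; set sp := spectral_diag H => /=.
rewrite invmx_unitary // => HE.
have sp0 i : 0 <= sp 0 i.
  suff -> : sp 0 i = ((P^t* *m (evec i) : 'cV[C]_N)^t* *m H *m
      (P^t* *m (evec i))) 0 0 by [].
  have PHP : P *m H *m P^t* = diag_mx sp.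
    by rewrite HE !mulmxA (unitarymxP PU) mul1mx mulmxtVK.
  rewrite adjmxM trmxCK -!mulmxA [H *m _]mulmxA [P *m _]mulmxA [P *m _]mulmxA.
  rewrite PHP [_ *m (_ *m _)]mulmxA.
  by rewrite delta_quadE !mxE !eqxx mulr1n.
exists (P^t*), (fun i => complex.Re (sp 0 i)); split.
- by rewrite trmxC_unitary.
- by move=> i; have [] := ge0_ReE (sp0 i).
rewrite {1}HE /from_spectrum trmxCK; congr (_ *m diag_mx _ *m _).
by apply/rowP => i; rewrite !mxE; have [] := ge0_ReE (sp0 i).
Qed.

Lemma psd_conj H i j : psd_form H -> H i j = ((H j i)^*)%R.
Proof. by case=> Hh _; rewrite {1}Hh !mxE. Qed.

(** The form of the Schur complement at v is the form of H at
    v - (c / H(t,t)) e_t with c = h^* v, the minimizer over multiples of e_t. *)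
Lemma psd_schur H t : psd_form H -> psd_form (schur_step H t).
Proof.
move=> Hp; have [Hh Hq] := Hp; have [Htr _] := ge0_ReE (psd_diag_ge0 t Hp).
split.
  rewrite /schur_step adjmxB adjmxZ -Hh; congr (_ - _ *: _).
    by rewrite Htr fmorphV /= conj_realC.
  by rewrite adjmxM trmxCK.
move=> v; have [H0|Hn0] := eqVneq (H t t) 0.
  by rewrite /schur_step H0 invr0 scale0r subr0.
set h := col t H; set a := H t t.
have hE : h = H *m (evec t) by rewrite -colE.
have haE : h^t* = (evec t)^t* *m H by rewrite hE adjmxM -Hh.
have aC : (a^*)%R = a by rewrite {1}/a Htr conj_realC -Htr.
pose c := (h^t* *m v) 0 0.
have hv : h^t* *m v = c%:M by rewrite /c -mx11_scalar.
have vh : v^t* *m h = ((c^*)%R)%:M.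
  rewrite -[h]trmxCK -adjmxM hv; apply/matrixP => i j.
  by rewrite !mxE !ord1 eqxx.
have dHd : (evec t)^t* *m H *m (evec t) = a%:M :> 'M[C]_1.
  by rewrite [LHS]mx11_scalar delta_quadE.
have := Hq (v - (c / a) *: (evec t)).
suff -> : (v - (c / a) *: (evec t))^t* *m H *m (v - (c / a) *: (evec t))
     = v^t* *m schur_step H t *m v by [].
have vHe : v^t* *m H *m evec t = ((c^*)%R)%:M by rewrite -mulmxA -hE.
have eHv : (evec t)^t* *m H *m v = c%:M by rewrite -haE.
have -> : v^t* *m schur_step H t *m v
    = v^t* *m H *m v - a^-1 *: (((c^*)%R)%:M *m c%:M).
  rewrite /schur_step -/h -/a mulmxBr mulmxBl -scalemxAr -scalemxAl.
  by rewrite mulmxA vh -[_%:M *m _ *m v]mulmxA hv.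
(* All five terms are now 1 x 1; compare them as scalars. *)
have kC : ((c / a)^*)%R = (c^*)%R / a by rewrite rmorphM fmorphV /= aC.
rewrite adjmxB adjmxZ kC !(mulmxBl, mulmxBr) -!scalemxAl -!scalemxAr -?scalemxAl.
rewrite vHe eHv dHd -addrA; congr (_ + _).
rewrite -scalar_mxM !scale_scalar_mx.
apply/matrixP => i j; rewrite !mxE !ord1 eqxx !mulr1n.
by field.
Qed.

(** A diagonal entry is the sum of lam_l |U(t,l)|^2; if it vanishes then so does
    each lam_l U(t,l), and these are the weights of column t. *)
Lemma psd_col0 H t : psd_form H -> H t t = 0 -> col t H = 0.
Proof.
move=> Hp; have [U [lam [UU lam0 HE]]] := psd_spectrum Hp.
rewrite -(delta_quadE H) HE quad_spectrumE => /eqP.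
rewrite psumr_eq0 => [/allP /= h|l _]; last first.
  by rewrite mulr_ge0 ?exprn_ge0 // lecR.
rewrite colE -/(evec t) /from_spectrum -!mulmxA.
suff -> : diag_mx (\row_i ((lam i)%:C)%C) *m (U^t* *m (evec t)) = 0 :> 'cV[C]_N.
  by rewrite mulmx0.
apply/colP => l; rewrite mul_diag_mx !mxE.
have := h l (mem_index_enum _); rewrite mulf_eq0 sqrf_eq0 normr_eq0.
by rewrite mxE => /orP[/eqP->|/eqP->]; rewrite ?mul0r ?mulr0.
Qed.

End Psd.

(** * Sums of principal minors *)

Lemma poly_eq_nat (F : numDomainType) (p q : {poly F}) :
  (forall n : nat, p.[n%:R] = q.[n%:R]) -> p = q.
Proof.
move=> pq; apply/eqP; rewrite -subr_eq0; apply/eqP.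
apply: (@roots_geq_poly_eq0 _ _ [seq n%:R | n <- iota 0 (size (p - q))]).
- by apply/allP => _ /mapP[n _ ->]; rewrite rootE hornerD hornerN pq subrr.
- by rewrite map_inj_uniq ?iota_uniq // => i j /eqP; rewrite eqr_nat => /eqP.
- by rewrite size_map size_iota.
Qed.

Section MinorSums.
Variables (R : realType) (N : nat).
Local Notation C := (R[i]).
Implicit Types (H U : 'M[C]_N) (lam : 'I_N -> R).
Local Open Scope complex_scope.

(** The polynomial det(1 + X H), whose coefficients are the elementary symmetric
    functions of the eigenvalues. *)
Definition specpoly lam : {poly R} := \prod_i (1 + lam i *: 'X).

(** Sum over ordered m-tuples of pivots of the product of the pivots met along
    the way.  Each product is a principal minor of H, so this is m! times the
    m-th elementary symmetric function of the eigenvalues. *)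
Fixpoint minor_sum (m : nat) H : R :=
  if m is m'.+1 then \sum_t complex.Re (H t t) * minor_sum m' (schur_step H t)
  else 1.

Lemma unitary_adjK U : U \is unitarymx -> U^t* *m U = 1%:M.
Proof.
by rewrite -trmxC_unitary => /unitarymxP; rewrite trmxCK.
Qed.

Lemma eq_from_spectrum U lam mu : lam =1 mu ->
  from_spectrum U lam = from_spectrum U mu.
Proof.
move=> e; rewrite /from_spectrum; congr (_ *m diag_mx _ *m _).
by apply/rowP => i; rewrite !mxE e.
Qed.

Lemma from_spectrumE U lam i j :
  from_spectrum U lam i j = \sum_l (lam l)%:C * (U i l * (U j l)^*)%R.
Proof.
rewrite /from_spectrum mul_mx_diag !mxE; apply: eq_bigr => l _.
by rewrite !mxE mulrAC mulrC.
Qed.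

Lemma from_spectrum_lin U lam mu (x : R) :
  from_spectrum U (fun i => lam i + x * mu i)
    = from_spectrum U lam + x%:C *: from_spectrum U mu.
Proof.
apply/matrixP => i j; rewrite [RHS]mxE [X in _ + X]mxE !from_spectrumE.
rewrite mulr_sumr -big_split /=.
by apply: eq_bigr => l _; rewrite rmorphD rmorphM /= mulrDl !mulrA.
Qed.

Lemma from_spectrum1 U : U \is unitarymx -> from_spectrum U (fun=> 1) = 1%:M.
Proof.
move=> /unitarymxP UU; apply/matrixP => i j; rewrite from_spectrumE -UU !mxE.
by apply: eq_bigr => l _; rewrite mul1r !mxE.
Qed.

Lemma det_from_spectrum U lam : U \is unitarymx ->
  \det (from_spectrum U lam) = (\prod_i lam i)%:C.
Proof.
move=> UU; rewrite /from_spectrum !det_mulmx mulrAC -det_mulmx.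
rewrite (unitarymxP UU) det1 mul1r det_diag rmorph_prod.
by apply: eq_bigr => i _; rewrite mxE.
Qed.

Lemma from_spectrumM U lam mu : U \is unitarymx ->
  from_spectrum U lam *m from_spectrum U mu
    = from_spectrum U (fun i => lam i * mu i).
Proof.
move=> UU; rewrite /from_spectrum !mulmxA -[_ *m U^t* *m U]mulmxA unitary_adjK //.
rewrite mulmx1 -[U *m _ *m _]mulmxA mulmx_diag; congr (_ *m diag_mx _ *m _).
by apply/rowP => i; rewrite !mxE rmorphM.
Qed.

Lemma trace_from_spectrum U lam : U \is unitarymx ->
  \tr (from_spectrum U lam) = (\sum_i lam i)%:C.
Proof.
move=> UU; rewrite /from_spectrum mxtrace_mulC mulmxA unitary_adjK // mul1mx.
by rewrite mxtrace_diag rmorph_sum; apply: eq_bigr => i _; rewrite mxE.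
Qed.

(** With M = 1 + x H, the left determinant is that of the rank-one perturbation
    M - (x / H(t,t)) h h^*, so it equals
    det M (1 - x h^* M^-1 h / H(t,t)); and H - x H M^-1 H = H M^-1. *)
Lemma schur_det U lam H (x : R) t : U \is unitarymx ->
    (forall i, 0 <= lam i) -> H = from_spectrum U lam -> 0 <= x ->
  H t t * \det (1%:M + x%:C *: schur_step H t)
    = (\prod_i (1 + x * lam i))%:C *
      (from_spectrum U (fun i => lam i / (1 + x * lam i))) t t.
Proof.
move=> UU lam0 HU x0.
have Hp : psd_form H by rewrite HU; exact: from_spectrum_psd.
pose nu i := 1 + x * lam i.
have nu0 i : nu i != 0 by rewrite gt_eqF // ltr_pwDl ?ltr01 // mulr_ge0.
(* M = 1 + x H and W = M^-1, as opaque names: the entries of products of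
   concrete matrices would otherwise be unfolded by mxE. *)
have [M MU] : exists M, M = from_spectrum U nu by eexists.
have [W WU] : exists W, W = from_spectrum U (fun i => (nu i)^-1) by eexists.
have ME : 1%:M + x%:C *: H = M.
  by rewrite HU MU -(from_spectrum1 UU) -from_spectrum_lin.
have MW : M *m W = 1%:M.
  rewrite MU WU from_spectrumM // -(from_spectrum1 UU).
  by apply: eq_from_spectrum => i; rewrite divff.
have -> : from_spectrum U (fun i => lam i / nu i) = H - x%:C *: (H *m W *m H).
  rewrite HU WU !from_spectrumM // -scaleNr -rmorphN -from_spectrum_lin.
  by apply: eq_from_spectrum => i; move: (nu0 i); rewrite /nu => n0; field.
(* A zero pivot has a zero column, so both sides vanish. *)
have [H0|Hn0] := eqVneq (H t t) 0.
  rewrite H0 mul0r [X in _ = _ * X]mxE H0 add0r !mxE.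
  rewrite [\sum_j _]big1 ?mulr0 ?oppr0 ?mulr0 // => j _.
  suff -> : H j t = 0 by rewrite mulr0.
  by have /colP/(_ j) := psd_col0 Hp H0; rewrite !mxE.
pose h := col t H.
have -> : 1%:M + x%:C *: schur_step H t =
    M *m (1%:M - (x%:C / H t t) *: (W *m h) *m h^t*).
  rewrite /schur_step -/h scalerBr addrA ME scalerA mulmxBr mulmx1.
  by rewrite -scalemxAl -scalemxAr -(mulmxA W) [M *m _]mulmxA MW mul1mx.
rewrite det_mulmx det_1B_rank1 MU det_from_spectrum // mulrCA; congr (_ * _).
have -> : (h^t* *m ((x%:C / H t t) *: (W *m h))) 0 0
    = x%:C / H t t * (H *m W *m H) t t.
  have -> : h^t* = row t H.
    by apply/rowP => j; rewrite !mxE [RHS](psd_conj _ _ Hp).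
  rewrite -scalemxAr mxE; congr (_ * _).
  by rewrite mulmxA -row_mul !mxE; apply: eq_bigr => j _; rewrite !mxE.
move: (H *m W *m H) => K; rewrite !mxE.
by field.
Qed.

Lemma deriv_prod_affine (I : Type) (s : seq I) (f : I -> R) (x : R) :
  (forall i, 1 + x * f i != 0) ->
  (\prod_(i <- s) (1 + f i *: 'X))^`().[x]
    = \prod_(i <- s) (1 + x * f i) * \sum_(i <- s) f i / (1 + x * f i).
Proof.
move=> nz; elim: s => [|i s IH].
  by rewrite !big_nil mulr0 derivC horner0.
rewrite !big_cons derivM derivD derivZ derivX derivC add0r alg_polyC.
rewrite hornerD !hornerM IH hornerC horner_prod !hornerE.
rewrite (eq_bigr (fun j => 1 + x * f j)); last by move=> j _; rewrite !hornerE mulrC.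
set P := \prod_(_ <- s) _; set S := \sum_(_ <- s) _.
move: (nz i) => n0; transitivity (f i * P + (1 + f i * x) * P * S) => //.
by field.
Qed.

(** Summing [schur_det] over t gives det M tr(H M^-1), the logarithmic
    derivative of det(1 + x H) times itself. *)
Lemma sum_schur_det U lam H (x : R) : U \is unitarymx ->
    (forall i, 0 <= lam i) -> H = from_spectrum U lam -> 0 <= x ->
  \sum_t H t t * \det (1%:M + x%:C *: schur_step H t)
    = ((specpoly lam)^`().[x])%:C.
Proof.
move=> UU lam0 HU x0; under eq_bigr do rewrite (schur_det _ UU lam0 HU x0).
rewrite -mulr_sumr (_ : \sum_t _ = \tr (from_spectrum U
  (fun i => lam i / (1 + x * lam i)))) // trace_from_spectrum // -rmorphM /=.
rewrite /specpoly deriv_prod_affine // => i.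
by rewrite gt_eqF // ltr_pwDl ?ltr01 // mulr_ge0.
Qed.

Lemma horner_specpoly U lam (x : R) : U \is unitarymx ->
  ((specpoly lam).[x])%:C = \det (1%:M + x%:C *: from_spectrum U lam).
Proof.
move=> UU; rewrite -(from_spectrum1 UU) -from_spectrum_lin det_from_spectrum //.
rewrite horner_prod; congr (_%:C); apply: eq_bigr => i _.
by rewrite !hornerE mulrC.
Qed.

(** [sum_schur_det] gives equality at every nonnegative x, hence of polynomials. *)
Lemma deriv_specpoly U lam H (mu : 'I_N -> 'I_N -> R) (V : 'I_N -> 'M[C]_N) :
    U \is unitarymx -> (forall i, 0 <= lam i) -> H = from_spectrum U lam ->
    (forall t, V t \is unitarymx) ->
    (forall t, schur_step H t = from_spectrum (V t) (mu t)) ->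
  (specpoly lam)^`() = \sum_t complex.Re (H t t) *: specpoly (mu t).
Proof.
move=> UU lam0 HU VU HV; apply: poly_eq_nat => n.
have n0 : 0 <= n%:R :> R by rewrite ler0n.
have : ((specpoly lam)^`().[n%:R])%:C
    = ((\sum_t complex.Re (H t t) *: specpoly (mu t)).[n%:R])%:C :> C; last by case.
rewrite -(sum_schur_det UU lam0 HU n0) horner_sum rmorph_sum.
apply: eq_bigr => t _; rewrite hornerZ rmorphM /= (horner_specpoly _ _ (VU t)).
have Hp : psd_form H by rewrite HU; exact: from_spectrum_psd.
by rewrite -HV; have [<-] := ge0_ReE (psd_diag_ge0 t Hp).
Qed.

(** Each further pivot sum is one more derivative, by [deriv_specpoly]. *)
Lemma minor_sumE m U lam H : U \is unitarymx -> (forall i, 0 <= lam i) ->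
    H = from_spectrum U lam -> minor_sum m H = (specpoly lam)^`(m).[0].
Proof.
elim: m U lam H => [|m IH] U lam H UU lam0 HU.
  rewrite derivn0 horner_prod big1 // => i _.
  by rewrite !hornerE.
have Hp : psd_form H by rewrite HU; exact: from_spectrum_psd.
have : forall t, exists Vmu : 'M[C]_N * ('I_N -> R),
    [/\ Vmu.1 \is unitarymx, forall i, 0 <= Vmu.2 i
      & schur_step H t = from_spectrum Vmu.1 Vmu.2].
  by move=> t; have [V [mu []]] := psd_spectrum (psd_schur t Hp); exists (V, mu).
move=> /fin_all_exists[Vmu VmuP].
rewrite derivSn (deriv_specpoly (V := fun t => (Vmu t).1)
  (mu := fun t => (Vmu t).2) UU lam0 HU) => [|t|t]; try by have [] := VmuP t.
rewrite /= (_ : (\sum_t _)^`(m) = \sum_t complex.Re (H t t) *: (specpoly (Vmu t).2)^`(m)).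
  rewrite horner_sum; apply: eq_bigr => t _; rewrite hornerZ.
  by have [Vt mut HV] := VmuP t; rewrite (IH _ _ _ Vt mut HV).
by rewrite linear_sum; apply: eq_bigr => t _; rewrite linearZ.
Qed.

End MinorSums.

(** * Traces of residuals *)

(** The identity is the diagonal matrix times its entrywise inverse, plus one
    rank-one matrix for every zero entry. *)
Lemma rank_diag_ge (F : fieldType) n (d : 'rV[F]_n) :
  (n <= \rank (diag_mx d) + #|[pred i | d 0%R i == 0%R]|)%N.
Proof.
pose Z := [pred i | d 0 i == 0%R].
have e : 1%:M = diag_mx d *m diag_mx (\row_i (d 0 i)^-1)
    + \sum_(i in Z) delta_mx i i.
  rewrite mulmx_diag; apply/matrixP => i j; rewrite !mxE summxE.
  have [<-{j}|ij] := eqVneq i j; last first.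
    rewrite mulr0n add0r big1 // => l _; rewrite mxE.
    by case: eqP => // <-; rewrite /= eq_sym (negPf ij).
  have [di0|di0] := eqVneq (d 0 i) 0.
    rewrite (bigD1 i) ?inE ?di0 //= big1 => [|l /andP[_ /negPf li]].
      by rewrite mxE eqxx ?di0 mul0r mulr1n add0r addr0.
    by rewrite mxE eq_sym li.
  rewrite big1 => [|l]; first by rewrite divff // addr0.
  rewrite inE => /eqP dl0; rewrite mxE.
  by case: eqP => //= il; rewrite il dl0 eqxx in di0.
rewrite -[X in (X <= _)%N](mxrank1 F n) e.
apply: leq_trans (mxrank_add _ _) (leq_add (mxrankM_maxl _ _) _).
rewrite -sum1_card; elim/big_rec2: _ => [|i m A _ IH]; first by rewrite mxrank0.
by apply: leq_trans (mxrank_add _ _) (leq_add _ IH); rewrite mxrank_delta.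
Qed.

Section Traces.
Variables (R : realType) (N : nat).
Local Notation C := (R[i]).
Implicit Types (H A K U V : 'M[C]_N) (lam : 'I_N -> R).
Local Open Scope complex_scope.

Lemma Re_sum (I : Type) (s : seq I) (P : pred I) (f : I -> C) :
  complex.Re (\sum_(i <- s | P i) f i) = \sum_(i <- s | P i) complex.Re (f i).
Proof. by elim/big_rec2: _ => [//|i x [a b] _ <-]; case: (f i). Qed.

Lemma ReB (x y : C) : complex.Re (x - y) = complex.Re x - complex.Re y.
Proof. by case: x; case: y. Qed.

Lemma ReZ (x : R) (z : C) : complex.Re (x%:C * z) = x * complex.Re z.
Proof. by case: z => a b /=; rewrite mul0r subr0. Qed.

Lemma retr_sum H : retr H = \sum_i complex.Re (H i i).
Proof. exact: Re_sum. Qed.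

Lemma Re_diag_ge0 H t : psd_form H -> 0 <= complex.Re (H t t).
Proof. by move=> /(psd_diag_ge0 t) /ge0_ReE []. Qed.

Lemma retr_ge0 H : psd_form H -> 0 <= retr H.
Proof. by move=> Hp; rewrite retr_sum sumr_ge0 // => i _; exact: Re_diag_ge0. Qed.

Lemma psd_conjugate U H : psd_form H -> psd_form (U^t* *m H *m U).
Proof.
move=> [Hh Hq]; split; first by rewrite !adjmxM trmxCK -Hh mulmxA.
by move=> v; have := Hq (U *m v); rewrite adjmxM !mulmxA.
Qed.

Lemma retr_conjugate U H : U \is unitarymx -> retr (U^t* *m H *m U) = retr H.
Proof.
move=> /unitarymxP UU.
by rewrite /retr -mulmxA mxtrace_mulC -mulmxA UU mulmx1.
Qed.

Lemma retrB A H : retr (A - H) = retr A - retr H.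
Proof. by rewrite /retr linearB /= ReB. Qed.

Lemma conjugate_spectrum U lam : U \is unitarymx ->
  U^t* *m from_spectrum U lam *m U = diag_mx (\row_i ((lam i)%:C)).
Proof.
move=> UU; rewrite /from_spectrum !mulmxA unitary_adjK // mul1mx.
by rewrite -mulmxA unitary_adjK // mulmx1.
Qed.

Lemma retr_from_spectrum U lam : U \is unitarymx ->
  retr (from_spectrum U lam) = \sum_i lam i.
Proof. by move=> UU; rewrite /retr trace_from_spectrum. Qed.

Lemma sqr_normC_Re (z : C) : complex.Re z ^+ 2 <= complex.Re (`|z| ^+ 2).
Proof. by rewrite -add_Re2_Im2 /= lerDl sqr_ge0. Qed.

Lemma retr_sqrE H : psd_form H ->
  retr (H *m H) = \sum_i \sum_j complex.Re (`|H i j| ^+ 2).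
Proof.
move=> Hp; rewrite retr_sum; apply: eq_bigr => i _; rewrite mxE Re_sum.
by apply: eq_bigr => j _; rewrite normCK [X in _ * X](psd_conj j i Hp).
Qed.

Lemma Re_sqr_ge0 (z : C) : 0 <= complex.Re (`|z| ^+ 2).
Proof. exact: le_trans (sqr_ge0 _) (sqr_normC_Re z). Qed.

Lemma sqr_sum_le (I : finType) (P : pred I) (f : I -> R) (r : nat) :
  (#|P| <= r)%N -> (\sum_(i | P i) f i) ^+ 2 <= r%:R * \sum_(i | P i) f i ^+ 2.
Proof.
case: r => [|r] Pr.
  have P0 : P =1 pred0 by apply/fintype.card0_eq/eqP; rewrite -leqn0.
  by rewrite !big_pred0 // expr0n mulr0.
set S := \sum_(i | P i) f i; pose c := S / r.+1%:R.
have rc : r.+1%:R * c = S by rewrite /c mulrC divfK // pnatr_eq0.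
have h : \sum_(i | P i) (2 * c * f i - c ^+ 2) <= \sum_(i | P i) f i ^+ 2.
  apply: ler_sum => i _; have := sqr_ge0 (f i - c).
  by rewrite sqrrB; lra.
rewrite sumrB -mulr_sumr -/S sumr_const in h.
have h2 : c ^+ 2 *+ #|P| <= r.+1%:R * c ^+ 2.
  by rewrite -mulr_natl ler_wpM2r ?sqr_ge0 // ler_nat.
have h3 : 2 * c * S - r.+1%:R * c ^+ 2 <= \sum_(i | P i) f i ^+ 2 by lra.
have := ler_wpM2l (ler0n R r.+1) h3.
suff -> : r.+1%:R * (2 * c * S - r.+1%:R * c ^+ 2) = S ^+ 2 by [].
by rewrite -rc; ring.
Qed.

Lemma card_ord_lt (r : nat) : (r <= N)%N ->
  #|[pred i : 'I_N | (i < r)%N]| = r.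
Proof.
by move=> rN; rewrite -sum1_card -(big_ord_widen _ (fun=> 1%N)) // sum1_card card_ord.
Qed.

Lemma card_ord_lt_leq (r : nat) : (#|[pred i : 'I_N | (i < r)%N]| <= r)%N.
Proof.
have [rN|Nr] := leqP r N; first by rewrite card_ord_lt.
by rewrite (leq_trans (max_card _)) // card_ord ltnW.
Qed.

Definition tail_sum lam (r : nat) : R := \sum_(i < N | (r <= i)%N) lam i.

Lemma tail_sum_ge0 lam r : (forall i, 0 <= lam i) -> 0 <= tail_sum lam r.
Proof. by move=> lam0; exact: sumr_ge0. Qed.

(** In the eigenbasis of A the diagonal entries of H after the first r sum to at
    most the tail of the spectrum, as H is dominated by A.  So the first r sum
    to at least tr H - tail, and Cauchy-Schwarz bounds them by the Frobenius
    norm. *)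
Lemma trace_sqr_ge U lam A H r : U \is unitarymx -> A = from_spectrum U lam ->
    psd_form H -> psd_form (A - H) -> tail_sum lam r <= retr H ->
  (retr H - tail_sum lam r) ^+ 2 <= r%:R * retr (H *m H).
Proof.
move=> UU AU Hp AHp tH; pose G := U^t* *m H *m U.
have Gp : psd_form G by exact: psd_conjugate Hp.
have -> : retr (H *m H) = retr (G *m G).
  rewrite -(retr_conjugate (H *m H) UU) /G !mulmxA.
  by rewrite -[_ *m U *m U^t*]mulmxA (unitarymxP UU) mulmx1.
have DG : psd_form (diag_mx (\row_i ((lam i)%:C)) - G).
  rewrite -(conjugate_spectrum lam UU) -AU /G -mulmxBl -mulmxBr.
  exact: psd_conjugate AHp.
have GS : retr H - tail_sum lam r <= \sum_(i < N | (i < r)%N) complex.Re (G i i).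
  rewrite -(retr_conjugate H UU) -/G retr_sum (bigID (fun i : 'I_N => (i < r)%N)) /=.
  rewrite lerBlDr lerD2l.
  under eq_bigl do rewrite -leqNgt.
  apply: ler_sum => i _; have := Re_diag_ge0 i DG.
  rewrite mxE [X in X + _]mxE [X in _ + X]mxE ReB eqxx mulr1n mxE /= subr_ge0.
  by [].
apply: (@le_trans _ _ ((\sum_(i < N | (i < r)%N) complex.Re (G i i)) ^+ 2)).
  by rewrite ler_sqr // nnegrE ?subr_ge0 // (le_trans _ GS) // subr_ge0.
apply: le_trans (sqr_sum_le _ (card_ord_lt_leq r)) _.
rewrite ler_wpM2l // retr_sqrE // [X in _ <= X](bigID (fun i : 'I_N => (i < r)%N)) /=.
rewrite -[X in X <= _]addr0 lerD //; last first.
  by apply: sumr_ge0 => i _; apply: sumr_ge0 => j _; exact: Re_sqr_ge0.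
apply: ler_sum => i _; rewrite (bigD1 i) //=.
rewrite -[X in X <= _]addr0 lerD ?sqr_normC_Re // sumr_ge0 // => j _.
exact: Re_sqr_ge0.
Qed.

Lemma retr_schur H t : psd_form H ->
  complex.Re (H t t) * retr (schur_step H t)
    = complex.Re (H t t) * retr H - \sum_i complex.Re (`|H t i| ^+ 2).
Proof.
move=> Hp; have [HttE Htt0] := ge0_ReE (psd_diag_ge0 t Hp).
have [H0|Hn0] := eqVneq (H t t) 0.
  rewrite H0 !mul0r big1 ?subr0 // => i _.
  have /colP/(_ i) := psd_col0 Hp H0; rewrite !mxE => Hit.
  by rewrite (psd_conj t i Hp) Hit rmorph0 normr0 expr0n.
have trE : \tr (schur_step H t) = \tr H - (H t t)^-1 * \sum_i `|H t i| ^+ 2.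
  rewrite /schur_step linearB linearZ /= mxtrace_mulC trace_mx11 mxE.
  congr (_ - _ * _); apply: eq_bigr => i _.
  rewrite !mxE normCK -(psd_conj i t Hp); congr (_ * _).
  exact: esym (psd_conj t i Hp).
have : H t t * \tr (schur_step H t) = H t t * \tr H - \sum_i `|H t i| ^+ 2.
  by rewrite trE mulrBr mulVKf.
have ReM z : complex.Re (H t t * z) = complex.Re (H t t) * complex.Re z.
  by rewrite [in LHS]HttE ReZ.
move=> /(congr1 (@complex.Re R)); rewrite ReB !ReM => ->.
by congr (_ - _); exact: Re_sum.
Qed.

(** Up to the factor tr H, the left side is the mean trace after a random pivot. *)
Lemma sum_retr_schur H : psd_form H ->
  \sum_t complex.Re (H t t) * retr (schur_step H t) = retr H ^+ 2 - retr (H *m H).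
Proof.
move=> Hp; under eq_bigr do rewrite retr_schur //.
by rewrite sumrB -mulr_suml -retr_sum -retr_sqrE.
Qed.

End Traces.

(** * Comparing minor sums and traces with the spectrum *)

Section Affine.
Variables (R : realFieldType) (I : Type).
Implicit Types (g : {poly R}) (s : seq I) (P : pred I) (f : I -> R).

(** Leibniz at 0.  The numbers p^`(m).[0] are m! times the coefficients; the
    bounds on them below are inductions along this recursion. *)
Lemma derivn_mul_affine g (a : R) m :
  ((1 + a *: 'X) * g)^`(m.+1).[0] = g^`(m.+1).[0] + m.+1%:R * a * g^`(m).[0].
Proof.
rewrite !horner_coef0 !coef_derivn !addn0 !ffactnn mulrDl mul1r coefD.
rewrite -scalerAl coefZ coefXM /= factS -[LHS]mulr_natl.
rewrite -[g`_m.+1 *+ _]mulr_natl -[g`_m *+ _]mulr_natl natrM.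
move: (m.+1%:R) ((m`!)%:R) => c d; ring.
Qed.

Lemma derivn0_mul_affine g (a : R) :
  ((1 + a *: 'X) * g)^`(0).[0] = g^`(0).[0].
Proof. by rewrite !derivn0 hornerM !hornerE. Qed.

Lemma exprD_ge_tangent (x a : R) m : 0 <= x -> 0 <= a ->
  x ^+ m.+1 + m.+1%:R * a * x ^+ m <= (a + x) ^+ m.+1.
Proof.
move=> x0 a0; elim: m => [|m IH]; first by rewrite !expr1 expr0; lra.
rewrite [X in _ <= X]exprS; apply: le_trans (ler_wpM2l (addr_ge0 a0 x0) IH).
(* The term by which the expanded right side exceeds the left. *)
have : 0 <= a * (m.+1%:R * a * x ^+ m) by rewrite !mulr_ge0 ?exprn_ge0.
rewrite !exprS -[m.+2%:R]natr1; lra.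
Qed.

Lemma derivn_prod_affine_ge0 s P f m : (forall i, 0 <= f i) ->
  0 <= (\prod_(i <- s | P i) (1 + f i *: 'X))^`(m).[0].
Proof.
move=> f0; elim: s m => [|i s IH] m.
  rewrite big_nil; case: m => [|m]; first by rewrite derivn0 hornerC.
  by rewrite derivSn derivC derivn_poly0 ?horner0 // size_poly0.
rewrite big_cons; case: (P i) => //; case: m => [|m].
  by rewrite derivn0_mul_affine.
by rewrite derivn_mul_affine addr_ge0 // !mulr_ge0.
Qed.

(** This is m! e_m <= e_1^m, the multinomial bound. *)
Lemma derivn_prod_affine_le s P f m : (forall i, 0 <= f i) ->
  (\prod_(i <- s | P i) (1 + f i *: 'X))^`(m).[0]
    <= (\sum_(i <- s | P i) f i) ^+ m.
Proof.
move=> f0; elim: s m => [|i s IH] m.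
  rewrite !big_nil; case: m => [|m]; first by rewrite derivn0 hornerC.
  by rewrite derivSn derivC derivn_poly0 ?horner0 ?size_poly0 // expr0n.
rewrite !big_cons; case: (P i) => //; case: m => [|m].
  by rewrite derivn0_mul_affine.
rewrite derivn_mul_affine; apply: le_trans (exprD_ge_tangent _ _ _) => //.
  by rewrite lerD // ler_wpM2l // mulr_ge0.
exact: sumr_ge0.
Qed.

Lemma derivn_prod_affine_eq0 s P f m : (count P s < m)%N ->
  (\prod_(i <- s | P i) (1 + f i *: 'X))^`(m).[0] = 0.
Proof.
elim: s m => [|i s IH] m /=.
  rewrite big_nil; case: m => // m _.
  by rewrite derivSn derivC derivn_poly0 ?horner0 // size_poly0.
rewrite big_cons; case: (P i) => /=; last exact: IH.
case: m => [|m] //; rewrite add1n ltnS => sm.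
by rewrite derivn_mul_affine !IH ?mulr0 ?addr0 // ltnW.
Qed.

(** Every new factor 1 + aX changes the bound by at most m (T + a) / T.  The
    powers of T are kept on the left so that T may be 0, and the maximum with 1
    covers m = 0. *)
Lemma derivn_prod_affineM_le s P f g T m :
    (forall i, 0 <= f i) -> 0 <= T ->
    (forall j, 0 <= g^`(j).[0] <= T ^+ j) ->
  ((\prod_(i <- s | P i) (1 + f i *: 'X)) * g)^`(m).[0] * T ^+ count P s
    <= (maxn m 1)%:R ^+ count P s * T ^+ m * \prod_(i <- s | P i) (T + f i).
Proof.
move=> f0 T0 gT; elim: s m => [|i s IH] m.
  rewrite !big_nil mul1r !expr0 !mulr1 mul1r.
  by have /andP[] := gT m.
rewrite !big_cons /=; case: (P i) => //=; rewrite -mulrA; case: m => [|m].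
  rewrite derivn0_mul_affine add1n [maxn 0 1]/= expr1n mul1r expr0 mul1r exprS.
  rewrite mulrCA; have := IH 0; rewrite [maxn 0 1]/= expr1n mul1r expr0 mul1r => h.
  apply: le_trans (ler_wpM2l T0 h) _.
  by rewrite ler_wpM2r ?lerDl // prodr_ge0 // => j _; rewrite addr_ge0.
rewrite derivn_mul_affine add1n mulrDl.
set Pi := \prod_(_ <- _ | _) (T + _); set n := count P s.
have Pi0 : 0 <= Pi by rewrite prodr_ge0 // => j _; rewrite addr_ge0.
have h1 := IH m.+1.
have h2 := IH m.
rewrite -/Pi -/n (maxn_idPl (ltn0Sn _)) in h1 h2 *.
have h3 : (maxn m 1)%:R ^+ n * T ^+ m * Pi <= m.+1%:R ^+ n * T ^+ m * Pi.
  rewrite -!mulrA ler_wpM2r ?mulr_ge0 ?exprn_ge0 // lerXn2r ?nnegrE //.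
  by rewrite ler_nat geq_max leqnSn.
have k1 := ler_wpM2l T0 h1.
have m0 : 0 <= m.+1%:R * f i * T by rewrite !mulr_ge0.
have k2 := ler_wpM2l m0 (le_trans h2 h3).
rewrite [T ^+ n.+1]exprS.
apply: le_trans (_ : _ <= T * (m.+1%:R ^+ n * T ^+ m.+1 * Pi) +
  m.+1%:R * f i * T * (m.+1%:R ^+ n * T ^+ m * Pi)) _.
  apply: le_trans (lerD k1 k2); rewrite le_eqVlt; apply/orP; left; apply/eqP; ring.
have -> : T * (m.+1%:R ^+ n * T ^+ m.+1 * Pi) +
  m.+1%:R * f i * T * (m.+1%:R ^+ n * T ^+ m * Pi)
  = (T + m.+1%:R * f i) * (m.+1%:R ^+ n * T ^+ m.+1 * Pi).
  by rewrite exprS; ring.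
have -> : m.+1%:R ^+ n.+1 * T ^+ m.+1 * ((T + f i) * Pi) =
  (m.+1%:R * (T + f i)) * (m.+1%:R ^+ n * T ^+ m.+1 * Pi).
  by rewrite [m.+1%:R ^+ n.+1]exprS; ring.
rewrite ler_wpM2r ?mulr_ge0 ?exprn_ge0 // mulrDr lerD2r.
by rewrite ler_peMl // ler1n.
Qed.

End Affine.

Section KyFan.
Variables (R : realType) (N : nat).
Local Notation C := (R[i]).
Implicit Types (H A K U V : 'M[C]_N) (lam : 'I_N -> R).
Local Open Scope complex_scope.

Definition nonincreasing_spectrum lam :=
  forall i j : 'I_N, (i <= j)%N -> lam j <= lam i.

(** Moving mass between the weights until it sits on the last N - j indices can
    only decrease the sum; comparing every term with lam_j times the change of
    weight expresses this at once. *)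
Lemma weighted_sum_ge_tail lam (w : 'I_N -> R) j :
    nonincreasing_spectrum lam -> (forall i, 0 <= lam i) ->
    (forall l, 0 <= w l <= 1) -> N%:R <= j%:R + \sum_l w l ->
  tail_sum lam j <= \sum_l lam l * w l.
Proof.
move=> mono lam0 w01 Nj.
have [Nlej|jN] := leqP N j.
  rewrite /tail_sum big_pred0 => [|i]; last by rewrite leqNgt (leq_trans (ltn_ord i)).
  by rewrite sumr_ge0 // => l _; rewrite mulr_ge0 //; have /andP[] := w01 l.
(* lam decreases through c at index j, so lam l - c and w l - [j <= l] have
   matching signs. *)
pose c := lam (Ordinal jN).
have h : \sum_l (c * (w l - (j <= l)%N%:R))
    <= \sum_l (lam l * w l - (if (j <= l)%N then lam l else 0)).
  apply: ler_sum => l _; have /andP[wl0 wl1] := w01 l.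
  case: leqP => jl; rewrite ?subr0.
    rewrite -[X in _ <= _ - X]mulr1 -mulrBr ler_wnM2r ?subr_le0 //.
    exact: mono.
  by rewrite ler_wpM2r //; apply: mono; exact: ltnW.
rewrite sumrB -big_mkcond -/(tail_sum _ _) -mulr_sumr sumrB -natr_sum in h.
rewrite -subr_ge0; apply: le_trans h; rewrite mulr_ge0 ?lam0 // subr_ge0.
suff -> : (\sum_(i < N) (j <= i) = N - j)%N by rewrite natrB 1?ltnW // lerBlDl.
rewrite -[RHS]muln1 -sum_nat_const_nat big_geq_mkord [RHS]big_mkcond /=.
by apply: eq_bigr => i _; case: leqP.
Qed.

Lemma unitary_row_sum U i : U \is unitarymx ->
  \sum_l complex.Re (`|U i l| ^+ 2) = 1.
Proof.
move=> /unitarymxP /matrixP /(_ i i); rewrite !mxE eqxx -Re_sum.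
rewrite (eq_bigr (fun l => `|U i l| ^+ 2)) => [->//|l _].
by rewrite !mxE normCK.
Qed.

Lemma unitary_col_sum U l : U \is unitarymx ->
  \sum_i complex.Re (`|U i l| ^+ 2) = 1.
Proof.
move=> UU; have := @unitary_row_sum (U^t*) l; rewrite trmxC_unitary => /(_ UU) <-.
by apply: eq_bigr => i _; rewrite !mxE norm_conjC.
Qed.

(** Ky Fan's principle.  A - H vanishes on at least N - j vectors of an
    orthonormal eigenbasis of A - H.  There H and A have the same quadratic
    form, and its sum over those vectors is a weighted sum of the eigenvalues
    of A with weights in [0, 1] of total mass at least N - j. *)
Lemma trace_ge_tail U lam A H j : U \is unitarymx -> A = from_spectrum U lam ->
    nonincreasing_spectrum lam -> (forall i, 0 <= lam i) ->
    psd_form H -> psd_form (A - H) -> (\rank (A - H)%R <= j)%N ->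
  tail_sum lam j <= retr H.
Proof.
move=> UU AU mono lam0 Hp AHp rj.
have [V [mu [VU mu0 AHV]]] := psd_spectrum AHp.
pose Z := [pred i | mu i == 0].
pose D := diag_mx (\row_i ((mu i)%:C)).
pose X := V^t* *m U.
have XU : X \is unitarymx.
  by apply: mul_unitarymx UU; rewrite trmxC_unitary; exact: VU.
have DE : V^t* *m (A - H) *m V = D by rewrite AHV conjugate_spectrum.
have cZ : (N <= j + #|Z|)%N.
  have := rank_diag_ge (\row_i ((mu i)%:C)); rewrite -/D => /leq_trans; apply.
  rewrite leq_add //; last first.
    apply: subset_leq_card; apply/fintype.subsetP => i.
    by rewrite !inE mxE eq_complex /= eqxx andbT.
  rewrite -DE; apply: leq_trans rj.
  by apply: leq_trans (mxrankM_maxl _ _) (mxrankM_maxr _ _).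
have XA : V^t* *m A *m V = from_spectrum X lam.
  by rewrite AU /from_spectrum /X adjmxM trmxCK !mulmxA.
have diagE i : i \in Z -> complex.Re ((V^t* *m H *m V) i i)
    = \sum_l lam l * complex.Re (`|X i l| ^+ 2).
  rewrite inE => /eqP mui.
  have : (V^t* *m A *m V) i i - (V^t* *m H *m V) i i = 0.
    have := congr1 (fun M : 'M[C]_N => M i i) DE.
    rewrite mulmxBr mulmxBl /D [X in X = _]mxE [X in _ + X]mxE => ->.
    by rewrite !mxE mui mul0rn.
  move=> /eqP; rewrite subr_eq0 => /eqP <-; rewrite XA from_spectrumE Re_sum.
  by apply: eq_bigr => l _; rewrite ReZ normCK.
apply: (@le_trans _ _ (\sum_(i in Z) complex.Re ((V^t* *m H *m V) i i))); last first.
  rewrite -(retr_conjugate H VU) retr_sum [X in _ <= X](bigID (mem Z)) /= lerDl.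
  by apply: sumr_ge0 => i _; apply/Re_diag_ge0/psd_conjugate.
rewrite (eq_bigr _ diagE) exchange_big /=.
under eq_bigr do rewrite -mulr_sumr.
apply: weighted_sum_ge_tail => // [l|].
  rewrite sumr_ge0 => [|i _]; last exact: Re_sqr_ge0.
  rewrite -(unitary_col_sum l XU) [X in _ <= X](bigID (mem Z)) /= lerDl.
  by apply: sumr_ge0 => i _; exact: Re_sqr_ge0.
rewrite exchange_big /= (eq_bigr (fun=> 1)) => [|i _]; last exact: unitary_row_sum.
by rewrite sumr_const -natrD ler_nat.
Qed.

Lemma tail_sum_gt0_ltn lam r : 0 < tail_sum lam r -> (r < N)%N.
Proof.
move=> t0; rewrite ltnNge; apply/negP => Nr; move: t0.
rewrite /tail_sum big_pred0 ?ltxx // => i.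
by rewrite leqNgt (leq_trans (ltn_ord i)).
Qed.

Lemma addr_tail_sum_le lam r (i : 'I_N) : (forall i, 0 <= lam i) -> (i < r)%N ->
  tail_sum lam r + lam i <= tail_sum lam i.
Proof.
move=> lam0 ir; rewrite /tail_sum [X in _ <= X](bigD1 i) //= addrC lerD2r.
rewrite big_mkcond [X in _ <= X]big_mkcond; apply: ler_sum => l _.
case: leqP => rl; last by case: ifP.
by rewrite (leq_trans (ltnW ir)) //= -(inj_eq val_inj) gtn_eqF // (leq_trans ir).
Qed.

(** The first r factors are compared with the eigenvalues, the others with y. *)
Lemma prod_traces_ge lam r m (x : nat -> R) (y : R) :
    (forall i, 0 <= lam i) -> 0 < tail_sum lam r -> (r <= m)%N -> 0 <= y ->
    (forall i, (i < m)%N -> tail_sum lam i <= x i) ->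
    (forall i, (i < m)%N -> y <= x i) ->
  \prod_(i < N | (i < r)%N) (tail_sum lam r + lam i) * y ^+ (m - r)
    <= \prod_(i < m) x i.
Proof.
move=> lam0 t0 rm y0 tx yx; have rN := tail_sum_gt0_ltn t0.
rewrite -(big_mkord xpredT) (@big_cat_nat _ _ _ r) //= ler_pM ?exprn_ge0 //.
- by apply: prodr_ge0 => i _; rewrite addr_ge0 // ltW.
- rewrite big_mkord (big_ord_widen _ _ (ltnW rN)); apply: ler_prod => i ir.
  rewrite addr_ge0 ?(ltW t0) //=; apply: le_trans (addr_tail_sum_le lam0 ir) (tx _ _).
  exact: leq_trans rm.
- rewrite -prodr_const_nat big_nat [X in _ <= X]big_nat.
  by apply: ler_prod => i /andP[_ im]; rewrite y0 yx.
Qed.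

Lemma specpoly_split lam r : specpoly lam =
  \prod_(i < N | (i < r)%N) (1 + lam i *: 'X)
    * \prod_(i < N | ~~ (i < r)%N) (1 + lam i *: 'X).
Proof. by rewrite /specpoly (bigID (fun i : 'I_N => (i < r)%N)). Qed.

Lemma count_index_enum (P : pred 'I_N) : count P (index_enum 'I_N) = #|P|.
Proof. by rewrite -sum1_count sum1_card. Qed.

(** [derivn_prod_affineM_le] with the r largest eigenvalues as explicit factors
    and the tail of the spectrum as T. *)
Lemma minor_sum_le U lam A r m : U \is unitarymx -> A = from_spectrum U lam ->
    (forall i, 0 <= lam i) -> 0 < tail_sum lam r -> (r < m)%N ->
  minor_sum m A <= m%:R ^+ r * tail_sum lam r ^+ (m - r)
    * \prod_(i < N | (i < r)%N) (tail_sum lam r + lam i).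
Proof.
move=> UU AU lam0 t0 rm; rewrite (minor_sumE _ UU lam0 AU) (specpoly_split _ r).
have rN := ltnW (tail_sum_gt0_ltn t0).
pose g := \prod_(i < N | ~~ (i < r)%N) (1 + lam i *: 'X).
have gT j : 0 <= g^`(j).[0] <= tail_sum lam r ^+ j.
  rewrite derivn_prod_affine_ge0 //=.
  apply: le_trans (derivn_prod_affine_le _ _ _ lam0) _.
  by rewrite /tail_sum; under eq_bigl do rewrite -leqNgt.
have h := derivn_prod_affineM_le (index_enum 'I_N) (fun i => (i < r)%N) m
  lam0 (ltW t0) gT.
rewrite count_index_enum card_ord_lt // (maxn_idPl (leq_ltn_trans (leq0n r) rm)) in h.
rewrite -(ler_pM2r (exprn_gt0 r t0)); apply: le_trans h _.
set P := (X in _ * X <= _); rewrite le_eqVlt; apply/orP; left.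
apply/eqP; rewrite -[X in _ * _ ^+ X * P = _](subnK (ltnW rm)) exprD.
by rewrite -!mulrA [_ ^+ r * P]mulrC.
Qed.

(** A matrix of rank at most r has no nonzero principal minor of larger order. *)
Lemma minor_sum_eq0 U lam A r m : U \is unitarymx -> A = from_spectrum U lam ->
    (forall i, 0 <= lam i) -> tail_sum lam r = 0 -> (r < m)%N ->
  minor_sum m A = 0.
Proof.
move=> UU AU lam0 t0 rm; rewrite (minor_sumE _ UU lam0 AU) (specpoly_split _ r).
rewrite [X in _ * X]big1 => [|i]; last first.
  rewrite -leqNgt => ri; move: t0 => /eqP; rewrite psumr_eq0 // => /allP /(_ i).
  by rewrite mem_index_enum ri => /(_ isT) /eqP ->; rewrite scale0r addr0.
rewrite mulr1 derivn_prod_affine_eq0 // count_index_enum.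
exact: leq_ltn_trans (card_ord_lt_leq _ _) rm.
Qed.

End KyFan.

(** * The law of the pivots on finite histories *)

Lemma sum_tuple0 (V : nmodType) (T : finType) (F : seq T -> V) :
  \sum_(h : 0.-tuple T) F h = F [::].
Proof.
rewrite (bigD1 [tuple]) //= big1 ?addr0 // => h /eqP; case.
exact: tuple0.
Qed.

Lemma sum_tuple_cons (V : nmodType) (T : finType) (i : nat) (F : seq T -> V) :
  \sum_(h : i.+1.-tuple T) F h = \sum_t \sum_(h : i.-tuple T) F (t :: h).
Proof.
rewrite pair_big /=.
rewrite (reindex (fun p : T * i.-tuple T => [tuple of p.1 :: p.2])) //=.
exists (fun h : i.+1.-tuple T => (thead h, [tuple of behead h])).
  by move=> [t h] _; rewrite theadE; congr pair; exact: val_inj.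
by move=> h _; rewrite [RHS]tuple_eta; exact: val_inj.
Qed.

Lemma sum_tuple_rcons (V : nmodType) (T : finType) (i : nat) (F : seq T -> V) :
  \sum_(h : i.+1.-tuple T) F h = \sum_(h : i.-tuple T) \sum_t F (rcons h t).
Proof.
elim: i F => [|i IH] F.
  rewrite sum_tuple_cons (sum_tuple0 (fun h => \sum_t F (rcons h t))).
  by apply: eq_bigr => t _; rewrite (sum_tuple0 (fun h => F (t :: h))).
rewrite sum_tuple_cons (sum_tuple_cons _ (fun h => \sum_t F (rcons h t))).
by apply: eq_bigr => t _; rewrite (IH (fun h => F (t :: h))).
Qed.

(** Convexity of the power function, in the form used for Jensen's inequality. *)
Lemma tangent_pow (F : realDomainType) (x c : F) n : 0 <= x -> 0 <= c ->
  c ^+ n.+1 + n.+1%:R * c ^+ n * (x - c) <= x ^+ n.+1.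
Proof.
move=> x0 c0; elim: n => [|n IH]; first by rewrite !expr1 expr0; lra.
rewrite [X in _ <= X]exprS; apply: le_trans (ler_wpM2l x0 IH).
rewrite -subr_ge0.
have -> : x * (c ^+ n.+1 + n.+1%:R * c ^+ n * (x - c))
    - (c ^+ n.+2 + n.+2%:R * c ^+ n.+1 * (x - c))
    = n.+1%:R * c ^+ n * (x - c) ^+ 2.
  by rewrite -[n.+2%:R]natr1 !exprS; move: n.+1%:R => b; ring.
by rewrite mulr_ge0 ?sqr_ge0 // mulr_ge0 ?exprn_ge0.
Qed.

Section Process.
Variables (R : realType) (N : nat).
Local Notation C := (R[i]).
Implicit Types (H A K U V : 'M[C]_N) (lam : 'I_N -> R) (h : seq 'I_N).
Local Open Scope complex_scope.

(** Histories list the pivots in the order in which they are drawn. *)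
Definition residual A h := foldl (@schur_step R N) A h.

Lemma residual_rcons A h t :
  residual A (rcons h t) = schur_step (residual A h) t.
Proof. by rewrite /residual foldl_rcons. Qed.

Lemma residual_psd A h : psd_form A -> psd_form (residual A h).
Proof.
elim: h A => [|t h IH] A Ap; first exact: Ap.
exact: IH (psd_schur t Ap).
Qed.

Lemma psd_formD A H : psd_form A -> psd_form H -> psd_form (A + H).
Proof.
move=> [Ah Aq] [Hh Hq]; split.
  by apply/matrixP => i j; rewrite {1}Ah {1}Hh !mxE rmorphD.
by move=> v; rewrite mulmxDr mulmxDl mxE addr_ge0.
Qed.

Lemma psd_rank1 (a : C) (v : 'cV[C]_N) : 0 <= a -> psd_form (a *: (v *m v^t*)).
Proof.
move=> a0; split.
  rewrite adjmxZ adjmxM trmxCK; congr (_ *: _).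
  by have [-> _] := ge0_ReE a0; rewrite conj_realC.
move=> w; rewrite -scalemxAr -scalemxAl [w^t* *m (v *m _)]mulmxA.
rewrite -[_ *m v^t* *m w]mulmxA mxE mulr_ge0 //.
have -> : w^t* *m v = (v^t* *m w)^t* by rewrite adjmxM trmxCK.
move: (v^t* *m w) => z; rewrite mxE big_ord1 !mxE mulrC.
exact: mul_conjC_ge0.
Qed.

Lemma subr_schur A H t :
  A - schur_step H t = A - H + (H t t)^-1 *: (col t H *m (col t H)^t*).
Proof. by rewrite /schur_step opprD opprK addrA. Qed.

Lemma sub_residual_psd A h : psd_form A -> psd_form (A - residual A h).
Proof.
move=> Ap; elim/last_ind: h => [|h t IH].
  rewrite subrr; split; first by apply/matrixP => i j; rewrite !mxE rmorph0.
  by move=> v; rewrite mulmx0 mul0mx mxE.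
rewrite residual_rcons subr_schur; apply: psd_formD; first exact: IH.
apply: psd_rank1; rewrite invr_ge0; apply: psd_diag_ge0.
exact: residual_psd Ap.
Qed.

Lemma rank_sub_residual A h : (\rank (A - residual A h)%R <= size h)%N.
Proof.
elim/last_ind: h => [|h t IH]; first by rewrite subrr mxrank0.
rewrite residual_rcons subr_schur size_rcons -[X in (_ <= X)%N]addn1.
apply: leq_trans (mxrank_add _ _) (leq_add IH _).
apply: leq_trans (mxrank_scale _ _) _.
by apply: leq_trans (mxrankM_maxl _ _) (rank_leq_col _).
Qed.

Lemma retr_schur_le H t : psd_form H -> retr (schur_step H t) <= retr H.
Proof.
move=> Hp; have [H0|Hn0] := eqVneq (H t t) 0.
  by rewrite /schur_step H0 invr0 scale0r subr0.
have [HttE Htt0] := ge0_ReE (psd_diag_ge0 t Hp).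
have Hgt : 0 < complex.Re (H t t).
  rewrite lt_neqAle Htt0 andbT eq_sym; apply: contraNneq Hn0 => e.
  by rewrite HttE e.
rewrite -(ler_pM2l Hgt) retr_schur // gerBl sumr_ge0 // => i _.
exact: Re_sqr_ge0.
Qed.

Lemma retr_residual_le H h : psd_form H -> retr (residual H h) <= retr H.
Proof.
elim: h H => //= t h IH H Hp.
by apply: le_trans (retr_schur_le t Hp); apply/IH/psd_schur.
Qed.

Lemma retr_residual_take A h j : psd_form A ->
  retr (residual A h) <= retr (residual A (take j h)).
Proof.
move=> Ap; rewrite -{1}(cat_take_drop j h) /residual foldl_cat.
by apply: retr_residual_le; exact: residual_psd.
Qed.

(** p h is the probability that the first pivots are h.  The rule is written as a
    product, so that it also holds after the algorithm has stopped and for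
    histories of probability zero. *)
Definition pivot_law A (k : nat) (p : seq 'I_N -> R) : Prop :=
  [/\ p [::] = 1, forall h, 0 <= p h,
      forall h, (size h < k)%N -> \sum_t p (rcons h t) = p h
    & forall h t, (size h < k)%N ->
        p (rcons h t) * retr (residual A h)
          = p h * complex.Re (residual A h t t)].

Section Law.
Variables (A : 'M[C]_N) (k : nat) (p : seq 'I_N -> R).
Hypothesis pA : pivot_law A k p.
Hypothesis Ap : psd_form A.
Local Notation x h := (retr (residual A h)).

Lemma law_mass i : (i <= k)%N -> \sum_(h : i.-tuple 'I_N) p h = 1.
Proof.
case: pA => p1 _ pS _.
elim: i => [|i IH] ik; first by rewrite (sum_tuple0 p).
rewrite (sum_tuple_rcons _ p) -[RHS](IH (ltnW ik)).
by apply: eq_bigr => h _; rewrite pS // size_tuple.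
Qed.

(** Multiplying the probability of a pivot by the trace of the residual leaves
    the diagonal entry, which is exactly the weight in [minor_sum]. *)
Lemma law_minor_sum i m : (i <= k)%N ->
  \sum_(h : i.-tuple 'I_N) p h * \prod_(j < i) x (take j h)
      * minor_sum m (residual A h) = minor_sum (m + i) A.
Proof.
case: pA => p1 _ _ pV; elim: i m => [|i IH] m ik.
  rewrite (sum_tuple0 (fun h => p h * \prod_(j < 0) x (take j h)
      * minor_sum m (residual A h))).
  by rewrite big_ord0 p1 !mul1r addn0.
rewrite (sum_tuple_rcons _ (fun h => p h * \prod_(j < i.+1) x (take j h)
      * minor_sum m (residual A h))).
rewrite addnS -addSn -IH; last exact: ltnW.
apply: eq_bigr => h _; rewrite [minor_sum m.+1 _]/= mulr_sumr; apply: eq_bigr => t _.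
have hk : (size h < k)%N by rewrite size_tuple.
rewrite residual_rcons big_ord_recr /= -cats1 takel_cat ?size_tuple //.
rewrite [take i h]take_oversize ?size_tuple // cats1.
rewrite (eq_bigr (fun j : 'I_i => x (take j h))) => [|j _]; last first.
  by rewrite -cats1 takel_cat // size_tuple ltnW.
set P := \prod_(_ < _) _; set M := minor_sum _ _.
transitivity (p (rcons h t) * x h * P * M); first by ring.
by rewrite pV //; ring.
Qed.

Section Spectrum.
Variables (U : 'M[C]_N) (lam : 'I_N -> R).
Hypotheses (UU : U \is unitarymx) (AU : A = from_spectrum U lam)
  (lam0 : forall i, 0 <= lam i) (mono : nonincreasing_spectrum lam).

(** With i = k and m = 1, [law_minor_sum] computes the mean of the product of all
    traces; [minor_sum_le] bounds it from above and [prod_traces_ge] from below,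
    and the product over the large eigenvalues cancels.  When the tail is zero
    the mean product vanishes, so the last trace vanishes almost surely. *)
Lemma law_moment r : (r <= k)%N ->
  \sum_(h : k.-tuple 'I_N) p h * x h ^+ (k.+1 - r)
    <= k.+1%:R ^+ r * tail_sum lam r ^+ (k.+1 - r).
Proof.
move=> rk; have [_ p0 _ _] := pA.
have x0 h : 0 <= x h by apply/retr_ge0/residual_psd.
have xge (h : k.-tuple 'I_N) i : (i < k.+1)%N -> x h <= x (take i h).
  by move=> _; exact: retr_residual_take.
have m1 : \sum_(h : k.-tuple 'I_N) p h * \prod_(j < k.+1) x (take j h)
    = minor_sum k.+1 A.
  rewrite -(@law_minor_sum k 1) //; apply: eq_bigr => h _.
  rewrite big_ord_recr /= take_oversize ?size_tuple // mulrA; congr (_ * _).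
  by rewrite retr_sum; apply: eq_bigr => t _; rewrite mulr1.
have := tail_sum_ge0 r lam0; rewrite le_eqVlt => /orP[/eqP/esym t0|t0].
  rewrite t0 expr0n subn_eq0 leqNgt ltnS rk /= mulr0 sumr_le0 // => h _.
  have : \sum_(h : k.-tuple 'I_N) p h * \prod_(j < k.+1) x (take j h) = 0.
    by rewrite m1 (minor_sum_eq0 UU AU lam0 t0).
  move=> /eqP; rewrite psumr_eq0 => [/allP /(_ h)|h' _]; last first.
    by rewrite mulr_ge0 // prodr_ge0.
  rewrite mem_index_enum mulf_eq0 => /(_ isT) /orP[/eqP->|]; first by rewrite mul0r.
  rewrite prodf_seq_eq0 => /hasP[j _ /= /eqP xj].
  suff -> : x h = 0 by rewrite expr0n subn_eq0 leqNgt ltnS rk mulr0.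
  by apply/eqP; rewrite eq_le x0 -xj xge.
pose P := \prod_(i < N | (i < r)%N) (tail_sum lam r + lam i).
have P0 : 0 < P by apply: prodr_gt0 => i _; rewrite ltr_pwDl.
rewrite -(ler_pM2r P0) mulr_suml.
apply: le_trans (minor_sum_le UU AU lam0 t0 (_ : r < k.+1)%N) => //.
rewrite -m1; apply: ler_sum => h _; rewrite -mulrA ler_wpM2l // mulrC.
apply: (prod_traces_ge (x := fun j => x (take j h))) => //; first exact: leqW.
  move=> i ik.
  apply: (trace_ge_tail UU AU mono lam0 (residual_psd _ Ap)
    (sub_residual_psd _ Ap)).
  apply: leq_trans (rank_sub_residual _ _) _.
  by rewrite size_take_min geq_minl.
by move=> i ik; exact: xge.
Qed.

Definition mean_trace i := \sum_(h : i.-tuple 'I_N) p h * x h.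

Lemma law_step h : (size h < k)%N ->
  x h * (\sum_t p (rcons h t) * x (rcons h t))
    = p h * (x h ^+ 2 - retr (residual A h *m residual A h)).
Proof.
move=> hk; have [_ _ _ pV] := pA.
rewrite -sum_retr_schur; last exact: residual_psd.
rewrite !mulr_sumr; apply: eq_bigr => t _.
rewrite residual_rcons.
transitivity (p (rcons h t) * x h * retr (schur_step (residual A h) t)).
  by ring.
by rewrite pV // mulrA.
Qed.

Lemma law_step_le h : (size h < k)%N ->
  \sum_t p (rcons h t) * x (rcons h t) <= p h * x h.
Proof.
move=> hk; have [_ p0 pS _] := pA; rewrite -pS // mulr_suml.
apply: ler_sum => t _; rewrite ler_wpM2l // residual_rcons.
by apply/retr_schur_le/residual_psd.
Qed.

Lemma mean_trace_le i : (i < k)%N -> mean_trace i.+1 <= mean_trace i.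
Proof.
move=> ik; rewrite /mean_trace (sum_tuple_rcons _ (fun h => p h * x h)).
by apply: ler_sum => h _; apply: law_step_le; rewrite size_tuple.
Qed.

(** Given a residual of trace y > T, the mean decrease of the trace is at least
    (y - T)^2 / (r y) by [trace_sqr_ge].  This is convex in y, extended by 0
    below T, so it can be averaged after replacing it by its tangent l / r at
    the mean c. *)
Lemma mean_trace_drift r i : (0 < r)%N -> (i < k)%N ->
  tail_sum lam r < mean_trace i ->
  mean_trace i.+1 <= mean_trace i
    - (mean_trace i - tail_sum lam r) ^+ 2 / (r%:R * mean_trace i).
Proof.
move=> r0 ik; set c := mean_trace i; set T := tail_sum lam r => Tc.
have [_ p0 _ _] := pA.
have T0 : 0 <= T by exact: tail_sum_ge0.
have c0 : 0 < c by exact: le_lt_trans Tc.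
have rR : 0 < r%:R :> R by rewrite ltr0n.
(* l is the tangent at c of y |-> (y - T)^2 / y; it is at most 0 up to T. *)
pose l y := (c - T) ^+ 2 / c + (1 - T ^+ 2 / c ^+ 2) * (y - c).
have slope : 0 <= 1 - T ^+ 2 / c ^+ 2.
  by rewrite subr_ge0 ler_pdivrMr ?exprn_gt0 // mul1r ler_sqr ?nnegrE // ltW.
have key h : (size h < k)%N ->
    \sum_t p (rcons h t) * x (rcons h t) <= p h * (x h - l (x h) / r%:R).
  move=> hk; have [xT|Tx] := leP (x h) T.
    apply: le_trans (law_step_le hk) _; rewrite ler_wpM2l // lerDl oppr_ge0.
    rewrite pmulr_lle0 ?invr_gt0 //.
    apply: (@le_trans _ _ (l T)); first by rewrite lerD2l ler_wpM2l // lerD2r.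
    have -> : l T = - (T * (c - T) ^+ 2 / c ^+ 2) by rewrite /l; field; rewrite gt_eqF.
    by rewrite oppr_le0 !mulr_ge0 ?invr_ge0 ?exprn_ge0 ?subr_ge0 // ltW.
  have x0 : 0 < x h by exact: le_lt_trans Tx.
  rewrite -(ler_pM2l x0) law_step // mulrCA ler_wpM2l // expr2 mulrBr lerD2l lerN2.
  have := trace_sqr_ge UU AU (residual_psd h Ap) (sub_residual_psd h Ap) (ltW Tx).
  rewrite -/T; set y := x h in x0 Tx *; move=> sq.
  rewrite mulrA ler_pdivrMr // [X in _ <= X]mulrC; apply: le_trans sq.
  rewrite -subr_ge0.
  have -> : (y - T) ^+ 2 - y * l y = (T * (y - c) / c) ^+ 2.
    by rewrite /l; field; rewrite gt_eqF.
  exact: sqr_ge0.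
rewrite /mean_trace (sum_tuple_rcons _ (fun h => p h * x h)).
apply: (@le_trans _ _ (\sum_(h : i.-tuple 'I_N) p h * (x h - l (x h) / r%:R))).
  by apply: ler_sum => h _; apply: key; rewrite size_tuple.
have -> : \sum_(h : i.-tuple 'I_N) p h * (x h - l (x h) / r%:R) =
    \sum_(h : i.-tuple 'I_N) (p h * x h * (1 - (1 - T ^+ 2 / c ^+ 2) / r%:R)
      - p h * (((c - T) ^+ 2 / c - (1 - T ^+ 2 / c ^+ 2) * c) / r%:R)).
  by apply: eq_bigr => h _; rewrite /l; ring.
rewrite sumrB -!mulr_suml law_mass; last exact: ltnW.
rewrite -/(mean_trace i) -/c le_eqVlt; apply/orP; left; apply/eqP.
by field; rewrite !gt_eqF.
Qed.

Lemma jensen_pow i n : (i <= k)%N ->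
  mean_trace i ^+ n.+1 <= \sum_(h : i.-tuple 'I_N) p h * x h ^+ n.+1.
Proof.
move=> ik; set c := mean_trace i; have [_ p0 _ _] := pA.
have x0 h : 0 <= x h by apply/retr_ge0/residual_psd.
have c0 : 0 <= c by apply: sumr_ge0 => h _; rewrite mulr_ge0.
have -> : c ^+ n.+1 = \sum_(h : i.-tuple 'I_N)
    (p h * (c ^+ n.+1 - n.+1%:R * c ^+ n * c) + p h * x h * (n.+1%:R * c ^+ n)).
  rewrite big_split /= -!mulr_suml law_mass // -/(mean_trace i) -/c.
  by move: n.+1%:R => b; ring.
apply: ler_sum => h _; rewrite -[p h * _ * _]mulrA -mulrDr ler_wpM2l //.
apply: le_trans (tangent_pow n (x0 h) c0); rewrite le_eqVlt; apply/orP; left.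
by apply/eqP; move: n.+1%:R => b; ring.
Qed.

Lemma mean_trace_moment r (M : R) : (r <= k)%N -> 0 <= M ->
    k.+1%:R ^+ r <= M ^+ (k.+1 - r) ->
  mean_trace k <= M * tail_sum lam r.
Proof.
move=> rk M0 kM; have t0 := tail_sum_ge0 r lam0; have [_ p0 _ _] := pA.
have c0 : 0 <= mean_trace k.
  by apply: sumr_ge0 => h _; rewrite mulr_ge0 // retr_ge0 //; exact: residual_psd.
rewrite -(ler_pXn2r (ltn0Sn (k - r))) ?nnegrE ?mulr_ge0 //.
apply: le_trans (jensen_pow _ (leqnn k)) _.
rewrite -subSn //; apply: le_trans (law_moment rk) _.
by rewrite exprMn ler_wpM2r // exprn_ge0.
Qed.

End Spectrum.
End Law.

Lemma pivot_law_le A k j (p : seq 'I_N -> R) : (j <= k)%N ->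
  pivot_law A k p -> pivot_law A j p.
Proof.
move=> jk [p1 p0 pS pV]; split=> // h; first by move=> hj; rewrite pS // (leq_trans hj).
by move=> t hj; rewrite pV // (leq_trans hj).
Qed.

End Process.

(** * The Lambert function and the number of steps k_hp *)

Local Open Scope classical_set_scope.
Local Open Scope ring_scope.

Section Analysis.
Variable R : realType.
Implicit Types (x y z eps delta : R) (r m k : nat).

Lemma ln_le_subr1 x : 0 < x -> ln x <= x - 1.
Proof.
by move=> x0; have := @le_ln1Dx R (x - 1); rewrite [1 + _]addrC subrK; apply; lra.
Qed.

(** From the bound ln z <= z - 1 at z = 1 / (1 + x). *)
Lemma ln1D_ge x : 0 < x -> x / (1 + x) <= ln (1 + x).
Proof.
move=> x0; have y0 : 0 < 1 + x by lra.
have := @ln_le_subr1 (1 + x)^-1; rewrite invr_gt0 lnV ?posrE // => /(_ y0).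
have -> : x / (1 + x) = 1 - (1 + x)^-1 by field; rewrite gt_eqF.
lra.
Qed.

(** The maximum of x exp(-x) is at x = 1; it keeps the argument of the Lambert
    function above -1/e. *)
Lemma mulr_expN_le x : 0 <= x -> x * expR (- x) <= expR (-1).
Proof.
move=> x0; have := @expR_ge1Dx R (x - 1); rewrite [1 + _]addrC subrK => h.
have -> : expR (- x) = expR (-1) * expR (- (x - 1)) by rewrite -expRD; congr expR; ring.
rewrite mulrCA ler_piMr ?expR_ge0 // expRN ler_pdivrMr ?expR_gt0 //.
by rewrite mul1r.
Qed.

Lemma mulr_expN_le_div x : 0 < x -> x * expR (- x) <= 4 / x.
Proof.
move=> x0; have := @expR_ge1Dx R (x / 2) => h.
have e0 : 0 < expR (x / 2) by exact: expR_gt0.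
rewrite ler_pdivlMr // expRN mulrAC ler_pdivrMr ?expR_gt0 //.
have -> : x = x / 2 + x / 2 by field.
rewrite expRD -splitr; nra.
Qed.

(** On [-b, -1] the function w exp(w) takes values on both sides of x as soon as
    b >= 4 / -x, by [mulr_expN_le_div]. *)
Lemma lambertWm1P x : - expR (-1) <= x < 0 ->
  lambertWm1 x <= -1 /\ lambertWm1 x * expR (lambertWm1 x) = x.
Proof.
move=> /andP[xe x0]; apply: (@xgetPex R 0 [set w : R | w <= -1 /\ w * expR w = x]).
pose f (w : R) := w * expR w.
pose b := Num.max 1 (4 / - x).
have b1 : 1 <= b by rewrite le_max lexx.
have b0 : 0 < b by exact: lt_le_trans b1.
have cf : {within `[- b, -1], continuous f}.
  apply: continuous_subspaceT => w; apply: cvgM; first exact: cvg_id.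
  exact: continuous_expR.
have fb : x <= f (- b).
  rewrite /f mulNr lerNr; apply: le_trans (mulr_expN_le_div b0) _.
  rewrite ler_pdivrMr // mulrC -ler_pdivrMr ?oppr_gt0 //.
  by rewrite le_max lexx orbT.
have f1 : f (-1) <= x by rewrite /f mulN1r.
have bI : - b <= -1 by rewrite lerN2.
have xI : Num.min (f (- b)) (f (-1)) <= x <= Num.max (f (- b)) (f (-1)).
  by rewrite ge_min le_max f1 fb orbT.
have [w wI fw] := IVT bI cf xI.
by exists w; split=> //; move: wI; rewrite in_itv /= => /andP[].
Qed.

Section HighProbability.
Variables (r : nat) (eps delta : R).
Hypotheses (r1 : (1 <= r)%N) (eps01 : 0 < eps < 1) (delta01 : 0 < delta < 1).
Local Notation L := (ln (1 + eps)).
Local Notation kappa := (k_hp r eps delta).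

Let eps0 : 0 < eps. Proof. by case/andP: eps01. Qed.
Let r0 : 0 < r%:R :> R. Proof. by rewrite ltr0n. Qed.

Lemma ln1D_bounds : [/\ 0 < L, L <= eps, eps / (1 + eps) <= L & L <= 1].
Proof.
have [/andP[e0 e1]] := (eps01, delta01).
have h := ln1D_ge e0; have h2 : L <= eps by apply: le_ln1Dx; lra.
split=> //; last by lra.
by apply: lt_le_trans h; rewrite divr_gt0 //; lra.
Qed.

(** Taking logarithms in w exp(w) = -q and substituting w = - kappa L / r.  The
    condition w <= -1 becomes kappa >= r / L. *)
Lemma k_hp_eq : r%:R / L <= kappa /\ kappa * L = r%:R * ln kappa + r%:R * L - ln delta.
Proof.
have [L0 Le _ L1] := ln1D_bounds.
have /andP[d0 d1] := delta01.
have e1 : 0 < 1 + eps by lra.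
set q := L * delta `^ r%:R^-1 / (r%:R * (1 + eps)).
have p0 : 0 < delta `^ r%:R^-1 by exact: powR_gt0.
have q0 : 0 < q by rewrite /q divr_gt0 ?mulr_gt0.
have lnq : ln q = ln L + ln delta / r%:R - ln r%:R - L.
  rewrite /q lnM ?posrE ?mulr_gt0 ?invr_gt0 ?mulr_gt0 // lnM ?posrE //.
  rewrite lnV ?posrE ?mulr_gt0 // lnM ?posrE // ln_powR; ring.
have qI : - expR (-1) <= - q < 0.
  rewrite oppr_lt0 q0 andbT lerN2 -[q]lnK ?posrE //.
  apply: le_trans (mulr_expN_le (ltW L0)).
  rewrite -[X in X * expR _]lnK ?posrE // -expRD ler_expR lnq.
  have : ln delta <= 0 by rewrite ln_le0 // ltW.
  have : 0 <= ln r%:R :> R by rewrite ln_ge0 // ler1n.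
  have r0' := r0; move=> h1 h2.
  have : ln delta / r%:R <= 0 by rewrite pmulr_lle0 ?invr_gt0.
  lra.
have [w1 wq] := lambertWm1P qI.
set w := lambertWm1 (- q) in w1 wq *.
have kE : kappa = r%:R / L * - w by rewrite /k_hp -/q -/w; ring.
have nw0 : 0 < - w by lra.
have k0 : 0 < kappa by rewrite kE mulr_gt0 ?divr_gt0.
have lnk : ln kappa = ln r%:R - ln L + ln (- w).
  by rewrite kE lnM ?posrE ?divr_gt0 // lnM ?posrE ?invr_gt0 // lnV.
have lnw : ln (- w) + w = ln q.
  rewrite -[in X in _ + X](expRK w) -lnM ?posrE ?expR_gt0 //.
  by rewrite mulNr wq opprK.
split; first by rewrite kE ler_peMr ?(ltW (divr_gt0 r0 L0)) //; lra.
have -> : kappa * L = r%:R * - w by rewrite kE; field; rewrite gt_eqF.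
have : r%:R * (ln (- w) + w) = r%:R * ln q by rewrite lnw.
rewrite lnq; have -> : r%:R * (ln L + ln delta / r%:R - ln r%:R - L)
  = r%:R * (ln L - ln r%:R - L) + ln delta by field; rewrite gt_eqF.
by rewrite lnk; lra.
Qed.

Lemma k_hp_gt0 : 0 < kappa.
Proof.
have [L0 _ _ _] := ln1D_bounds.
by have [h _] := k_hp_eq; apply: lt_le_trans h; rewrite divr_gt0.
Qed.

Lemma k_hp_ge_rank : r%:R <= kappa.
Proof.
have [L0 _ _ L1] := ln1D_bounds.
have [h _] := k_hp_eq; apply: le_trans h.
by rewrite ler_pdivlMr // ler_piMr // ltW.
Qed.

(** By [k_hp_eq] equality holds at kappa.  The concave function
    r ln m - m L has nonpositive slope from r / L on, so it decreases after
    kappa. *)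
Lemma failure_weight_le m : (r <= m)%N -> kappa <= m%:R ->
  m%:R ^+ r <= delta * (1 + eps) ^+ (m - r).
Proof.
move=> rm km; have [L0 _ _ _] := ln1D_bounds; have [h e] := k_hp_eq.
have k0 := k_hp_gt0; have /andP[d0 _] := delta01.
have m0 : 0 < m%:R :> R by exact: lt_le_trans km.
have e1 : 0 < 1 + eps by have := eps0; lra.
rewrite -ler_ln ?posrE ?mulr_gt0 ?exprn_gt0 //.
rewrite lnM ?posrE ?exprn_gt0 // !lnXn // -[ln m%:R *+ _]mulr_natl.
rewrite -[L *+ _]mulr_natl natrB //.
have lnm : ln m%:R <= ln kappa + (m%:R / kappa - 1).
  rewrite -lerBlDl -ln_div ?posrE //; apply: ln_le_subr1.
  by rewrite divr_gt0.
have hk : r%:R * (m%:R / kappa - 1) <= L * (m%:R - kappa).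
  have -> : r%:R * (m%:R / kappa - 1) = (r%:R / kappa) * (m%:R - kappa).
    by field; rewrite gt_eqF.
  rewrite ler_wpM2r ?subr_ge0 // ler_pdivrMr // mulrC -ler_pdivrMr //.
have := ler_wpM2l (ltW r0) lnm.
rewrite mulrDr; lra.
Qed.

(** With the tangent of ln at c = 2 r / L, half of kappa L absorbs the linear
    term: kappa L / 2 <= r ln c + ln(1/delta).  Then L >= eps / 2. *)
Lemma k_hp_le : kappa
  <= 4 * r%:R / eps * ln (4 * r%:R / eps) + 4 / eps * ln (1 / delta).
Proof.
have [L0 Le Lge L1] := ln1D_bounds; have [h e] := k_hp_eq.
have /andP[d0 d1] := delta01; have /andP[e0 e1] := eps01.
have k0 := k_hp_gt0.
have L2 : eps / 2 <= L.
  apply: le_trans Lge; rewrite ler_pM2l // lef_pV2 ?posrE //; lra.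
have c4 : 2 * r%:R / L <= 4 * r%:R / eps.
  rewrite ler_pdivrMr // mulrAC ler_pdivlMr //.
  have := ler_wpM2l (ltW r0) L2; lra.
have i4 : 2 / L <= 4 / eps.
  by rewrite ler_pdivrMr // mulrAC ler_pdivlMr //; lra.
have c0 : 0 < 2 * r%:R / L by rewrite !mulr_gt0 ?invr_gt0.
set c := 2 * r%:R / L in c4 c0.
have c1 : 1 <= c.
  rewrite /c ler_pdivlMr // mul1r; have : 1 <= r%:R :> R by rewrite ler1n.
  lra.
have lnk : ln kappa <= ln c + (kappa / c - 1).
  rewrite -lerBlDl -ln_div ?posrE //; apply: ln_le_subr1.
  by rewrite divr_gt0.
have kc : r%:R * (kappa / c) = kappa * L / 2.
  by rewrite /c; field; rewrite !gt_eqF.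
have k1 : kappa * L / 2 <= r%:R * ln c - ln delta.
  have := ler_wpM2l (ltW r0) lnk; rewrite !mulrDr kc.
  have : r%:R * L <= r%:R by rewrite ler_piMr // ltW.
  lra.
have lnd : 0 <= - ln delta by rewrite oppr_ge0 ln_le0 // ltW.
have -> : ln (1 / delta) = - ln delta by rewrite mul1r lnV.
apply: (@le_trans _ _ (c * ln c + 2 / L * - ln delta)).
  rewrite -(ler_pM2r (divr_gt0 L0 (ltr0Sn R 1))).
  have -> : (c * ln c + 2 / L * - ln delta) * (L / 2) = r%:R * ln c - ln delta.
    by rewrite /c; field; rewrite gt_eqF.
  by rewrite mulrA.
rewrite lerD //; last exact: ler_wpM2r.
apply: ler_pM => //; first exact: ltW.
  exact: ln_ge0.
by rewrite ler_ln // posrE (lt_le_trans c0).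
Qed.

End HighProbability.
End Analysis.

(** * Asymptotics of k_hp *)

Section Asymptotics.
Variable R : realType.
Implicit Types (x y z eps delta : R) (r m k : nat).

(** Put y = kappa L / r and let q be eps / r times the denominator.  Then
    y = ln y + q + ln(eps / L) + L, so y >= q, and since ln y <= eta y - ln eta,
    also (1 - eta) y <= q + 2 - ln eta <= (1 + eta) q.  The ratio is
    (eps / L) (y / q), and eps / L lies between 1 and 1 + eps. *)
Lemma k_hp_ratio_bounds r eps delta (eta : R) : (1 <= r)%N -> 0 < eps < 1 ->
    0 < delta < 1 -> 0 < eta < 1 -> eps <= eta ->
    2 - ln eta <= eta * ln r%:R ->
  1 <= k_hp r eps delta
        / (r%:R / eps * ln (r%:R / eps) + 1 / eps * ln (1 / delta))
    <= (1 + eta) ^+ 2 / (1 - eta).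
Proof.
move=> r1 eps01 delta01 /andP[eta0 eta1] epseta hr.
have [L0 Le Lge L1] := ln1D_bounds eps01 delta01.
have [h e] := k_hp_eq r1 eps01 delta01.
have k0 := k_hp_gt0 r1 eps01 delta01.
have /andP[d0 d1] := delta01; have /andP[e0 e1] := eps01.
have r0 : 0 < r%:R :> R by rewrite ltr0n.
set kappa := k_hp r eps delta in h e k0 *; set L := ln (1 + eps) in L0 Le Lge L1 h e *.
have lnd : 0 < - ln delta by rewrite oppr_gt0 ln_lt0 // d0.
have lne : 0 < - ln eps by rewrite oppr_gt0 ln_lt0 // e0.
have -> : ln (1 / delta) = - ln delta by rewrite mul1r lnV.
pose q := ln r%:R - ln eps - ln delta / r%:R.
have -> : r%:R / eps * ln (r%:R / eps) + 1 / eps * - ln delta = r%:R / eps * q.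
  by rewrite ln_div ?posrE // /q; field; rewrite !gt_eqF.
have lnr : 0 <= ln r%:R :> R by rewrite ln_ge0 // ler1n.
have ld : 0 < - ln delta / r%:R by rewrite divr_gt0.
have q0 : 0 < q by rewrite /q; lra.
have [y yD] : exists y : R, y = kappa * L / r%:R by eexists.
have y1 : 1 <= y by rewrite yD ler_pdivlMr // mul1r -ler_pdivrMr.
have y0 : 0 < y by lra.
have kE : kappa = y * r%:R / L by rewrite yD; field; rewrite !gt_eqF.
have lnk : ln kappa = ln y + ln r%:R - ln L.
  by rewrite kE ln_div ?posrE ?mulr_gt0 // lnM ?posrE.
have yE : y = ln y + ln r%:R - ln L + L - ln delta / r%:R.
  by rewrite -lnk {1}yD e; field; rewrite gt_eqF.
have lnL : ln L <= ln eps by rewrite ler_ln ?posrE.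
have ly0 : 0 <= ln y by rewrite ln_ge0.
have eL : eps / L <= 1 + eps.
  by rewrite ler_pdivrMr // mulrC -ler_pdivrMr //; lra.
have lneL : ln eps - ln L <= eps.
  rewrite -ln_div ?posrE //; apply: le_trans (ln_le_subr1 _) _; last by lra.
  by rewrite divr_gt0.
have lny : ln y <= eta * y - ln eta.
  have := @ln_le_subr1 _ (eta * y); rewrite mulr_gt0 // => /(_ isT).
  by rewrite lnM ?posrE //; lra.
have -> : kappa / (r%:R / eps * q) = (eps / L) * (y / q).
  by rewrite kE; field; rewrite !gt_eqF.
have qy : q <= y by rewrite [X in _ <= X]yE /q; lra.
apply/andP; split.
  rewrite -[X in X <= _]mulr1; apply: ler_pM => //; rewrite ler_pdivlMr // mul1r //.
have yup : (1 - eta) * y <= (1 + eta) * q.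
  have lq : eta * ln r%:R <= eta * q by rewrite ler_wpM2l ?(ltW eta0) // /q; lra.
  have : y <= eta * y - ln eta + q + 2 by rewrite [X in X <= _]yE /q; lra.
  lra.
have e1' : 0 < 1 - eta by lra.
rewrite expr2 -[X in _ <= X]mulrA; apply: ler_pM.
- by rewrite divr_ge0 // ltW.
- by rewrite divr_ge0 // ltW.
- lra.
by rewrite ler_pdivrMr // mulrAC ler_pdivlMr // mulrC.
Qed.

Lemma k_hp_asymptotics :
  ((fun p : nat * R * R =>
      let: (r, eps, delta) := p in
      k_hp r eps delta
        / (r%:R / eps * ln (r%:R / eps) + 1 / eps * ln (1 / delta)))
    @ filter_prod (filter_prod \oo 0^'+) 0^'+ --> (1 : R)).
Proof.
apply/cvgrPdist_lt => e e0.
(* For eta <= 1/8 and 8 eta <= e, (1 + eta)^2 < (1 + e) (1 - eta). *)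
pose eta := Num.min e 1 / 8.
have m0 : 0 < Num.min e 1 by rewrite lt_min e0 ltr01.
have me : Num.min e 1 <= e by rewrite ge_min lexx.
have m1 : Num.min e 1 <= 1 by rewrite ge_min lexx orbT.
have eta0 : 0 < eta by rewrite /eta; lra.
pose B := (2 - ln eta) / eta.
exists ([set q : nat * R | expR B <= q.1%:R /\ (1 <= q.1)%N /\ 0 < q.2 < eta],
        [set d : R | 0 < d < 1]).
  split=> /=.
    exists ([set n : nat | expR B <= n%:R /\ (1 <= n)%N], [set x : R | 0 < x < eta]).
      split=> /=.
        near=> n; split; last by near: n; exact: nbhs_infty_ge.
        near: n; exact: nbhs_infty_ger.
      near=> x; apply/andP; split; near: x; first exact: nbhs_right_gt.
      exact: nbhs_right_lt.
    by move=> [n x] /= [[? ?] ?].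
  near=> x; apply/andP; split; near: x; first exact: nbhs_right_gt.
  exact: nbhs_right_lt.
move=> [[r eps] delta] /= [[Br [r1 /andP[eps0 epseta]]] d01].
have eta1 : eta < 1 by rewrite /eta; lra.
have eps01 : 0 < eps < 1 by rewrite eps0 (lt_trans epseta).
have hr : 2 - ln eta <= eta * ln r%:R.
  rewrite mulrC -ler_pdivrMr // -/B -[B]expRK ler_ln ?posrE ?expR_gt0 //.
  by rewrite ltr0n.
have /andP[lo up] : _ <= _ <= _ := k_hp_ratio_bounds r1 eps01 d01
  (introT andP (conj eta0 eta1)) (ltW epseta) hr.
rewrite distrC ger0_norm ?subr_ge0 // ltrBlDr.
apply: le_lt_trans up _; rewrite ltr_pdivrMr ?subr_gt0 //.
have : eta <= e / 8 by rewrite /eta; lra.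
have : eta <= 1 / 8 by rewrite /eta; lra.
nra.
Unshelve. all: by end_near. Qed.

End Asymptotics.

(** * Convergence of the mean trace and failure probability *)

Section Expectation.
Variable R : realType.
Implicit Types (x y z eps delta : R) (r m k : nat).

(** The potential c ln u - c T / u is an antiderivative of c (u + T) / u^2, the
    inverse of the speed.  The speed increases with u and u decreases, so a step
    taken at the initial speed loses at least 1; in the proof this is
    ln q <= q - 1 and 1/q - 1 >= 1 - q for q = v / u. *)
Lemma drift_log (c T u v : R) : 0 < c -> 0 < T -> 0 < u -> 0 < v ->
    v <= u - u ^+ 2 / (c * (u + T)) ->
  1 <= (c * ln u - c * T / u) - (c * ln v - c * T / v).
Proof.
move=> c0 T0 u0 v0 vu.
pose q := v / u.
have q0 : 0 < q by rewrite divr_gt0.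
have vE : v = q * u by rewrite /q divfK // gt_eqF.
have lnq : ln q <= q - 1 by exact: ln_le_subr1.
have -> : ln v = ln q + ln u by rewrite vE lnM ?posrE.
have iq : 1 - q <= q^-1 - 1.
  have := @ln_le_subr1 _ q^-1; rewrite invr_gt0 lnV ?posrE // => /(_ q0); lra.
have Tv : c * T / v - c * T / u = c * T / u * (q^-1 - 1).
  by rewrite vE; field; rewrite !gt_eqF.
have cTu : 0 < c * T / u by rewrite !mulr_gt0 ?invr_gt0.
have h1 := ler_wpM2l (ltW cTu) iq.
have h2 := ler_wpM2l (ltW c0) lnq.
have h3 : 1 <= (c + c * T / u) * (1 - q).
  have uT : 0 < u + T by lra.
  have -> : (c + c * T / u) = c * (u + T) / u by field; rewrite gt_eqF.
  have k0 : 0 < c * (u + T) / u by rewrite !mulr_gt0 ?invr_gt0.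
  have e1 : c * (u + T) / u * (u / (c * (u + T))) = 1.
    by field; rewrite !gt_eqF.
  rewrite -[X in X <= _]e1 ler_pM2l // -(ler_pM2r u0) mulrBl mul1r -vE.
  have -> : u / (c * (u + T)) * u = u ^+ 2 / (c * (u + T)) by ring.
  lra.
rewrite mulrDr; lra.
Qed.

Lemma nonincreasing_upto (y : nat -> R) j k :
    (forall i, (i < k)%N -> y i.+1 <= y i) -> (j <= k)%N -> y k <= y j.
Proof.
move=> ymono jk; rewrite -(subnKC jk).
have : (j + (k - j) <= k)%N by rewrite subnKC.
elim: (k - j)%N => [|d IH] dk; first by rewrite addn0.
rewrite addnS in dk *; apply: le_trans (IH (ltnW dk)); exact: ymono.
Qed.

(** As long as y stays above (1 + eps) T, every step costs 1 of the potential of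
    y - T, which starts below c ln(M T) and stays above c ln(eps T) - c / eps. *)
Lemma drift_steps (y : nat -> R) (c T eps M : R) (j k : nat) :
    0 < c -> 0 < T -> 0 < eps -> (j <= k)%N ->
    (forall i, (i < k)%N -> y i.+1 <= y i) ->
    (forall i, (i < k)%N -> T < y i ->
       y i.+1 <= y i - (y i - T) ^+ 2 / (c * y i)) ->
    y j <= M * T -> (1 + eps) * T < y k ->
  (k - j)%:R < c * ln M + c * ln (1 / eps) + c / eps.
Proof.
move=> c0 T0 eps0 jk ymono ydrift yj yk.
have yki i : (i <= k)%N -> y k <= y i by move=> ik; exact: nonincreasing_upto.
have Tk : T < y k by apply: le_lt_trans yk; rewrite ler_peMl ?ltW //; lra.
pose G i := c * ln (y i - T) - c * T / (y i - T).
have steps d : (j + d <= k)%N -> d%:R <= G j - G (j + d)%N.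
  elim: d => [|d IH] dk; first by rewrite addn0 subrr.
  rewrite addnS in dk *; have := IH (ltnW dk).
  have Td : T < y (j + d)%N by rewrite (lt_le_trans Tk) // yki // ltnW.
  have Td1 : T < y (j + d).+1 by rewrite (lt_le_trans Tk) // yki.
  have : 1 <= G (j + d)%N - G (j + d).+1.
    apply: drift_log; rewrite ?subr_gt0 // subrK.
    by have := ydrift _ dk Td; lra.
  by rewrite -natr1; lra.
have := steps (k - j)%N; rewrite subnKC // => /(_ (leqnn _)) /le_lt_trans; apply.
have uj : 0 < y j - T by rewrite subr_gt0 (lt_le_trans Tk) // yki.
have uk : eps * T < y k - T by lra.
have eT : 0 < eps * T by exact: mulr_gt0.
have yT : 0 < y k - T by exact: lt_trans uk.
have M1 : 1 < M.
  by rewrite -(ltr_pM2r T0) mul1r; lra.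
have M0 : 0 < M by lra.
have Gj : G j <= c * (ln M + ln T).
  rewrite /G; have : c * ln (y j - T) <= c * (ln M + ln T).
    rewrite ler_wpM2l ?(ltW c0) // -lnM ?posrE // ler_ln ?posrE ?mulr_gt0 //; lra.
  have : 0 < c * T / (y j - T) by rewrite !mulr_gt0 ?invr_gt0.
  lra.
have Gk : c * (ln eps + ln T) - c / eps < G k.
  rewrite /G; have h1 : c * (ln eps + ln T) < c * ln (y k - T).
    by rewrite ltr_pM2l // -lnM ?posrE // ltr_ln ?posrE.
  have : c * T / (y k - T) < c / eps.
    have -> : c / eps = c * T / (eps * T) by field; rewrite !gt_eqF.
    by rewrite ltr_pM2l ?mulr_gt0 // ltf_pV2 ?posrE.
  lra.
have -> : ln (1 / eps) = - ln eps by rewrite mul1r lnV.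
lra.
Qed.

(** The integer m is the floor of (1 + a) r, so rounding costs nothing.  Writing
    n = m + 1, n - r is at least a r, hence r ln r = r a^2 <= a (n - r), while
    r ln(n / r) <= n - r.  The choice a = sqrt(ln r) balances the length of
    this phase, about a r, against r times the logarithm of the factor M that
    it leaves, about r (ln r) / a. *)
Lemma exists_burn_in r : (1 <= r)%N ->
  let a := Num.sqrt (ln r%:R) : R in
  exists m : nat, [/\ (r <= m)%N, m%:R <= (1 + a) * r%:R
    & r%:R * ln m.+1%:R <= (1 + a) * (m.+1 - r)%:R].
Proof.
move=> r1 a; have r0 : 0 < r%:R :> R by rewrite ltr0n.
have a0 : 0 <= a by exact: sqrtr_ge0.
have a2 : a ^+ 2 = ln r%:R by rewrite sqr_sqrtr // ln_ge0 // ler1n.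
have x0 : 0 <= (1 + a) * r%:R by rewrite mulr_ge0 ?(ltW r0) //; lra.
have /andP[t1 t2] := truncn_itv x0.
set m := Num.truncn _ in t1 t2; exists m.
have rm : (r <= m)%N.
  rewrite -ltnS -(ltr_nat R); apply: le_lt_trans t2.
  by rewrite ler_peMl ?(ltW r0) //; lra.
split=> //; rewrite natrB ?leqW //.
have m0 : 0 < m.+1%:R :> R by rewrite ltr0n.
have lnm : ln m.+1%:R <= ln r%:R + (m.+1%:R / r%:R - 1) :> R.
  rewrite -lerBlDl -ln_div ?posrE //; apply: ln_le_subr1.
  by rewrite divr_gt0.
have := ler_wpM2l (ltW r0) lnm; rewrite -a2.
have -> : r%:R * (a ^+ 2 + (m.+1%:R / r%:R - 1)) = r%:R * a ^+ 2 + (m.+1%:R - r%:R).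
  by field; rewrite gt_eqF.
have := ler_wpM2l a0 (ltW t2).
by move: (m.+1%:R) => M; lra.
Qed.

End Expectation.

Section Bounds.
Variables (R : realType) (N : nat).
Local Notation C := (R[i]).
Variables (A U : 'M[C]_N) (lam : 'I_N -> R) (k r : nat) (p : seq 'I_N -> R).
Variables (eps delta : R).
Hypotheses (pA : pivot_law A k p) (UU : U \is unitarymx)
  (AU : A = from_spectrum U lam) (lam0 : forall i, 0 <= lam i)
  (mono : nonincreasing_spectrum lam).
Hypotheses (r1 : (1 <= r)%N) (eps01 : 0 < eps < 1).

Let Ap : psd_form A. Proof. by rewrite AU; exact: from_spectrum_psd. Qed.

(** The first j steps give a mean trace of at most M tau with ln M <= 1 + a;
    [drift_steps] bounds how long the rest can take. *)
Lemma mean_trace_approx :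
    r%:R / eps + 2 * r%:R * Num.sqrt (ln r%:R) + r%:R * ln (1 / eps)
      + 23 / 10 * r%:R <= k%:R ->
  mean_trace A p k <= (1 + eps) * tail_sum lam r.
Proof.
move=> hk; have [j [rj jr rlnj]] := exists_burn_in R r1.
have /andP[e0 e1] := eps01.
have r0 : 0 < r%:R :> R by rewrite ltr0n.
set a := Num.sqrt _ in hk jr rlnj.
have a0 : 0 <= a by exact: sqrtr_ge0.
have le0 : 0 < ln (1 / eps) by rewrite mul1r lnV // oppr_gt0 ln_lt0 // e0.
have ar : 0 <= a * r%:R by rewrite mulr_ge0 // ltW.
have re : 0 < r%:R / eps by rewrite divr_gt0.
have rle : 0 < r%:R * ln (1 / eps) by rewrite mulr_gt0.
have jk : (j <= k)%N by rewrite -(ler_nat R); lra.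
have n0 : (0 < j.+1 - r)%N by rewrite subn_gt0.
(* M is the (j + 1 - r)-th root of (j + 1)^r. *)
pose M := @expR R (r%:R * ln j.+1%:R / (j.+1 - r)%:R).
have lnM : ln M <= 1 + a.
  by rewrite expRK ler_pdivrMr ?ltr0n.
have Mj : j.+1%:R ^+ r <= M ^+ (j.+1 - r).
  rewrite -expRM_natl mulrC divfK ?pnatr_eq0 -?lt0n // expRM_natl lnK //.
  by rewrite posrE ltr0n.
have yj : mean_trace A p j <= M * tail_sum lam r.
  apply: (mean_trace_moment (pivot_law_le jk pA) Ap UU AU lam0 mono rj _ Mj).
  exact: expR_ge0.
have ymono i : (i < k)%N -> mean_trace A p i.+1 <= mean_trace A p i.
  by move=> ik; exact: (mean_trace_le pA Ap).
have := tail_sum_ge0 r lam0; rewrite le_eqVlt => /orP[/eqP t0|t0].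
  rewrite -t0 !mulr0 in yj *; apply: le_trans yj.
  exact: nonincreasing_upto.
rewrite leNgt; apply/negP => yk.
have := drift_steps r0 t0 e0 jk ymono _ yj yk.
have : forall i, (i < k)%N -> tail_sum lam r < mean_trace A p i ->
  mean_trace A p i.+1 <= mean_trace A p i
    - (mean_trace A p i - tail_sum lam r) ^+ 2 / (r%:R * mean_trace A p i).
  by move=> i ik; exact: (mean_trace_drift pA Ap UU AU lam0).
move=> hd /(_ hd); rewrite natrB //.
have := ler_wpM2l (ltW r0) lnM; lra.
Qed.

(** Markov's inequality for the moment of [law_moment], with
    [failure_weight_le]. *)
Lemma failure_mass_le : 0 < delta < 1 -> k_hp r eps delta <= k%:R ->
  \sum_(h : k.-tuple 'I_N | (1 + eps) * tail_sum lam r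
      < retr (residual A h)) p h <= delta.
Proof.
move=> delta01 hk; have /andP[e0 e1] := eps01; have /andP[d0 d1] := delta01.
have [_ p0 _ _] := pA.
have rk : (r <= k)%N.
  by rewrite -(ler_nat R) (le_trans (k_hp_ge_rank r1 eps01 delta01)).
have rk1 : (r <= k.+1)%N by exact: leqW.
(* The moment of order k + 1 - r is available, one more than the number of
   steps would suggest, because the trace of the last residual counts too. *)
have w : k.+1%:R ^+ r <= delta * (1 + eps) ^+ (k.+1 - r).
  apply: failure_weight_le => //; apply: le_trans hk _.
  by rewrite ler_nat.
have T0 := tail_sum_ge0 r lam0.
have mom := law_moment pA Ap UU AU lam0 mono rk.
set n := (k.+1 - r)%N in w mom; set T := tail_sum lam r in T0 mom *.
pose b := (1 + eps) * T.
have b0 : 0 <= b by rewrite mulr_ge0 //; lra.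
have x0 (h : seq 'I_N) : 0 <= retr (residual A h).
  by apply/retr_ge0/residual_psd.
have n0 : (0 < n)%N by rewrite subn_gt0 ltnS.
have := T0; rewrite le_eqVlt => /orP[/eqP t0|t0].
  rewrite big1 ?(ltW d0) // => h; rewrite -t0 mulr0 => xh.
  rewrite -t0 expr0n -[n == 0%N]negbK -lt0n n0 mulr0 in mom.
  have : \sum_(h : k.-tuple 'I_N) p h * retr (residual A h) ^+ n = 0.
    apply/eqP; rewrite eq_le mom sumr_ge0 // => h' _.
    by rewrite mulr_ge0 ?exprn_ge0.
  move=> /eqP; rewrite psumr_eq0 => [/allP /(_ h)|h' _]; last first.
    by rewrite mulr_ge0 ?exprn_ge0.
  rewrite mem_index_enum mulf_eq0 expf_eq0 (gt_eqF xh) andbF orbF => /(_ isT).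
  by move=> /eqP.
have bgt : 0 < b by rewrite mulr_gt0 //; lra.
rewrite -(ler_pM2r (exprn_gt0 n bgt)) mulr_suml.
apply: (@le_trans _ _ (\sum_(h : k.-tuple 'I_N) p h
   * retr (residual A h) ^+ n)).
  rewrite big_mkcond; apply: ler_sum => h _; case: ifP => [/ltW bx|_].
    by rewrite ler_wpM2l // lerXn2r ?nnegrE.
  by rewrite mulr_ge0 ?exprn_ge0.
apply: le_trans mom _; rewrite /b exprMn mulrA ler_wpM2r ?exprn_ge0 //.
Qed.

End Bounds.

(** * From the probability space to finite histories *)

Section FiniteLaw.
Context (d : measure_display) (T : measurableType d) (R : realType).
Context (P : probability T R).

(** A function of a random variable with finitely many values is a combination
    of indicators. *)
Lemma integral_finite_valued (I : finType) (X : T -> I) (g : I -> R) :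
    (forall i, measurable [set w | X w = i]) -> (forall i, 0 <= g i) ->
  (\int[P]_w (g (X w))%:E
    = (\sum_i fine (P [set w | X w = i]) * g i)%:E)%E.
Proof.
move=> mX g0.
have -> : (fun w => (g (X w))%:E)
    = (fun w => (\sum_(i : I) (g i * \1_[set w | X w = i] w)%:E)%E).
  apply/funext => w; rewrite sumEFin; congr (_%:E).
  rewrite (bigD1 (X w)) //= indicE mem_set // mulr1 big1 ?addr0 // => i iX.
  rewrite indicE memNset ?mulr0 //= => e; by rewrite e eqxx in iX.
rewrite ge0_integral_sum //; first last.
- by move=> i w _; rewrite lee_fin mulr_ge0.
- move=> i; apply/measurable_EFinP; apply: measurable_funM => //.
rewrite -sumEFin; apply: eq_bigr => i _.
rewrite (integralZl_indic measurableT (fun=> [set w | X w = i])) //; last first.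
  by move=> /lt_geF; rewrite g0.
rewrite integral_indic // setIT mulrC EFinM fineK //.
exact: fin_num_measure.
Qed.

Section Trajectory.
Variables (N k : nat) (s : nat -> T -> 'I_N).
Hypothesis ms : forall (i : nat) (t : 'I_N), (i < k)%N ->
  measurable [set w | s i w = t].

Definition history (n : nat) (w : T) : seq 'I_N := mkseq (fun j => s j w) n.

Lemma history_size n w : size (history n w) == n.
Proof. by rewrite size_mkseq. Qed.

Definition history_tuple n w : n.-tuple 'I_N := Tuple (history_size n w).

Definition history_prob (h : seq 'I_N) : R :=
  fine (P [set w | history (size h) w = h]).

Lemma historyS_eq h t w : (history (size h).+1 w = rcons h t)
  = (history (size h) w = h /\ s (size h) w = t).
Proof.
rewrite /history mkseqS; apply/propext; split=> [|[-> ->] //].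
by move=> /rcons_inj [-> ->].
Qed.

Lemma measurable_history h : (size h <= k)%N ->
  measurable [set w | history (size h) w = h].
Proof.
elim/last_ind: h => [|h t IH] hk.
  rewrite (_ : [set _ | _] = setT) //.
  by apply/seteqP; split=> w _ //=.
rewrite size_rcons in hk *.
rewrite (_ : [set _ | _]
    = [set w | history (size h) w = h] `&` [set w | s (size h) w = t]).
  by apply: measurableI; [apply/IH/ltnW | exact: ms].
by apply/seteqP; split=> w /=; rewrite historyS_eq.
Qed.

Lemma history_tuple_eq n (h : n.-tuple 'I_N) :
  [set w | history_tuple n w = h] = [set w | history (size h) w = h].
Proof.
apply/seteqP; split=> w /=; rewrite size_tuple; first by move=> <-.
by move=> e; exact: val_inj.
Qed.

Lemma measurable_history_tuple n (h : n.-tuple 'I_N) : (n <= k)%N ->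
  measurable [set w | history_tuple n w = h].
Proof.
by move=> nk; rewrite history_tuple_eq; apply: measurable_history; rewrite size_tuple.
Qed.

Lemma integral_history n (g : seq 'I_N -> R) : (n <= k)%N -> (forall h, 0 <= g h) ->
  (\int[P]_w (g (history n w))%:E
    = (\sum_(h : n.-tuple 'I_N) history_prob h * g h)%:E)%E.
Proof.
move=> nk g0; rewrite (integral_finite_valued (X := history_tuple n)
  (g := fun h : n.-tuple 'I_N => g h)) //.
  by congr (_%:E); apply: eq_bigr => h _; rewrite history_tuple_eq.
by move=> h; exact: measurable_history_tuple.
Qed.

Lemma measurable_history_pred n (Q : pred (seq 'I_N)) : (n <= k)%N ->
  measurable [set w | Q (history n w)].
Proof.
move=> nk; rewrite (_ : [set _ | _]
    = \bigcup_(h in [set` [pred h : n.-tuple 'I_N | Q h]])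
        [set w | history_tuple n w = h]).
  rewrite bigcup_pred; apply: bigsetU_measurable => h _.
  exact: measurable_history_tuple.
apply/seteqP; split=> w /=; first by move=> Qw; exists (history_tuple n w).
by move=> [h /= Qh he]; move: Qh; rewrite -he.
Qed.

Lemma prob_history n (Q : pred (seq 'I_N)) : (n <= k)%N ->
  P [set w | Q (history n w)]
    = (\sum_(h : n.-tuple 'I_N | Q h) history_prob h)%:E.
Proof.
move=> nk; have mQ := measurable_history_pred Q nk.
have := integral_indic P measurableT mQ; rewrite setIT => <-.
have -> : (fun w => (\1_[set w | Q (history n w)] w)%:E : \bar R)
    = (fun w => ((Q (history n w))%:R)%:E).
  by apply/funext => w; rewrite indicE mem_setE.
rewrite (integral_history (g := fun h => (Q h)%:R)) //.
congr (_%:E); rewrite [RHS]big_mkcond; apply: eq_bigr => h _.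
by case: (Q h); rewrite ?mulr1 ?mulr0.
Qed.

Lemma history_prob_rcons h : (size h < k)%N ->
  \sum_t history_prob (rcons h t) = history_prob h.
Proof.
move=> hk; have := prob_history (fun h' => take (size h) h' == h) hk.
rewrite big_mkcond (sum_tuple_rcons _ (fun h' => if take (size h) h' == h
  then history_prob h' else 0)).
rewrite (bigD1 (in_tuple h)) //= [X in _ + X]big1 ?addr0; last first.
  move=> h' h'h; apply: big1 => t _.
  rewrite -cats1 take_size_cat ?size_tuple //.
  by rewrite -(inj_eq val_inj) /= in h'h; rewrite (negPf h'h).
rewrite (eq_bigr (fun t => history_prob (rcons h t))); last first.
  by move=> t _; rewrite -cats1 take_size_cat // eqxx.
move=> /(congr1 (@fine R)) /= <-; rewrite /history_prob; congr (fine (P _)).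
apply/seteqP; split=> w /=; rewrite /history mkseqS -cats1 take_size_cat ?size_mkseq //.
  by move/eqP.
by move=> ->.
Qed.

End Trajectory.
End FiniteLaw.

Section Algorithm.
Context (d : measure_display) (T : measurableType d) (R : realType).
Context (P : probability T R).
Variables (N k : nat) (s : nat -> T -> 'I_N) (A : 'M[R[i]]_N).

(** A zero residual has zero columns, so the stopping rule agrees with the
    unconditional Schur step. *)
Lemma sub_cholesky_step (Ahat : 'M[R[i]]_N) t :
  A - cholesky_step A Ahat t = schur_step (A - Ahat) t.
Proof.
rewrite /cholesky_step /schur_step; case: eqP => [-> | _].
  by rewrite !mxE invr0 scale0r subr0.
by rewrite opprD addrA mxE.
Qed.

Lemma sub_pivoted_cholesky (f : nat -> 'I_N) i :
  A - pivoted_cholesky A f i = residual A (mkseq f i).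
Proof.
elim: i => [|i IH]; first by rewrite subr0.
by rewrite mkseqS residual_rcons -IH -sub_cholesky_step.
Qed.

(** The conditional rule is only prescribed for histories of positive
    probability and nonzero residual; in the remaining cases both sides of the
    product form vanish. *)
Lemma random_pivots_law : psd_form A -> random_pivots P A k s ->
  pivot_law A k (history_prob P s).
Proof.
move=> Ap [ms rule]; split.
- rewrite /history_prob (_ : [set _ | _] = setT) ?probability_setT //.
  by apply/seteqP; split=> w _ //=.
- by move=> h; apply: fine_ge0.
- by move=> h hk; exact: history_prob_rcons hk.
move=> h t hk.
set H := residual A h.
have Hp : psd_form H by exact: residual_psd.
have [p0|p0] := eqVneq (history_prob P s h) 0.
  rewrite p0 mul0r; have := history_prob_rcons P ms hk; rewrite p0 => /eqP.
  rewrite psumr_eq0 => [/allP /(_ t)|t' _]; last exact: fine_ge0.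
  by rewrite mem_index_enum => /(_ isT) /eqP ->; rewrite mul0r.
have [H0|H0] := eqVneq H 0.
  by rewrite H0 /retr mxE linear0 /= !mulr0.
pose f := nth t h.
have fh : mkseq f (size h) = h by exact: mkseq_nth.
have pastE : past s (size h) f = [set w | history s (size h) w = h].
  apply/seteqP; split=> w /= e.
    rewrite -[RHS]fh; apply/eq_in_map => j; rewrite mem_iota => /andP[_ jh].
    exact: e.
  by move=> j jh; rewrite /f -[in RHS]e nth_mkseq.
have := rule (size h) f t hk; rewrite /= sub_pivoted_cholesky fh -/H pastE.
have Pn0 : P [set w | history s (size h) w = h] != 0%E.
  by apply: contraNneq p0 => e; rewrite /history_prob e.
move=> /(_ Pn0 H0); rewrite /cond_prob.
have -> : [set w | s (size h) w = t] `&` [set w | history s (size h) w = h]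
    = [set w | history s (size (rcons h t)) w = rcons h t].
  apply/seteqP; split=> w /=; rewrite size_rcons historyS_eq; first by case.
  by case.
rewrite -/(history_prob P s h) -/(history_prob P s (rcons h t)).
have [HttE _] := ge0_ReE (psd_diag_ge0 t Hp).
have trE : \tr H = ((retr H)%:C)%C.
  have : 0 <= \tr H by apply: sumr_ge0 => i _; exact: psd_diag_ge0.
  by move=> /ge0_ReE [].
rewrite trE HttE; have [t0|t0] := eqVneq (retr H) 0.
  move=> _; rewrite t0 mulr0.
  have := t0; rewrite retr_sum => /eqP; rewrite psumr_eq0; last first.
    by move=> i _; exact: Re_diag_ge0.
  by move=> /allP /(_ t); rewrite mem_index_enum => /(_ isT) /eqP /= ->; rewrite mulr0.
rewrite -fmorphV -rmorphM => -[] e.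
move: e => /(canRL (divfK p0)) ->.
by rewrite /=; field.
Qed.

End Algorithm.

(** * The approximation theorem *)

Section MainTheorem.
Variables (R : realType) (N : nat).
Implicit Types (A B U : 'M[R[i]]_N) (lam : 'I_N -> R).

(** The entries of lam are eigenvalues: the rows of U^* are eigenvectors of A. *)
Lemma psdmx_spectrum_ge0 A U lam : psdmx A -> U \is unitarymx ->
  A = from_spectrum U lam -> forall i, 0 <= lam i.
Proof.
move=> [_ Aev] UU AU i; rewrite -lecR; apply: Aev; apply/eigenvalueP.
have UA : U^t* *m A = diag_mx (\row_i ((lam i)%:C)%C) *m U^t*.
  by rewrite AU /from_spectrum !mulmxA unitary_adjK // mul1mx.
exists (row i (U^t*)).
  by rewrite -row_mul UA; apply/rowP => j; rewrite mxE mul_diag_mx !mxE.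
apply/eqP => r0; have := congr1 (row i) (unitary_adjK UU).
rewrite row_mul r0 mul0mx => /rowP/(_ i); rewrite !mxE eqxx => /eqP.
by rewrite eq_sym oner_eq0.
Qed.

Lemma retr_sub_truncation A U lam r B : U \is unitarymx ->
    A = from_spectrum U lam ->
    B = U *m diag_mx (\row_i (if (i < r)%N then ((lam i)%:C)%C else 0)) *m U^t* ->
  retr (A - B) = tail_sum lam r.
Proof.
move=> UU -> ->; rewrite retrB.
have -> : U *m diag_mx (\row_i (if (i < r)%N then ((lam i)%:C)%C else 0)) *m U^t*
    = from_spectrum U (fun i => if (i < r)%N then lam i else 0).
  by congr (_ *m diag_mx _ *m _); apply/rowP => i; rewrite !mxE; case: ifP.
rewrite !retr_from_spectrum // -sumrB /tail_sum [RHS]big_mkcond.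
by apply: eq_bigr => i _; case: ltnP => _; rewrite ?subrr ?subr0.
Qed.

End MainTheorem.

Theorem corollary1p3 (R : realType) :
  (forall (N : nat) (A : 'M[R[i]]_N) (r : nat) (eps delta : R)
      (B : 'M[R[i]]_N) (k : nat)
      (d : measure_display) (T : measurableType d) (P : probability T R)
      (s : nat -> T -> 'I_N),
    psdmx A -> (1 <= r)%N -> 0 < eps < 1 -> 0 < delta < 1 ->
    truncated_eigendecomposition A r B ->
    random_pivots P A k s ->
    (r%:R / eps + 2 * r%:R * Num.sqrt (ln r%:R) + r%:R * ln (1 / eps)
        + 23 / 10 * r%:R <= k%:R ->
      ('E_P[fun w => retr (A - rpcholesky A s k w)]
        <= ((1 + eps) * retr (A - B))%:E)%E)
    /\
    (k_hp r eps delta <= k%:R ->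
      (P [set w | ((1 + eps) * retr (A - B)
                    < retr (A - rpcholesky A s k w))%R] <= delta%:E)%E))
  /\
  (forall (r : nat) (eps delta : R),
    (1 <= r)%N -> 0 < eps < 1 -> 0 < delta < 1 ->
    k_hp r eps delta
      <= 4 * r%:R / eps * ln (4 * r%:R / eps) + 4 / eps * ln (1 / delta))
  /\
  ((fun p : nat * R * R =>
      let: (r, eps, delta) := p in
      k_hp r eps delta
        / (r%:R / eps * ln (r%:R / eps) + 1 / eps * ln (1 / delta)))
    @ filter_prod (filter_prod \oo 0^'+) 0^'+ --> (1 : R)).
Proof.
split; last split.
- move=> N A r eps delta B k d T P s Apsd r1 eps01 delta01 [U [lam [UU mono AU BU]]] law.
  have lam0 := psdmx_spectrum_ge0 Apsd UU AU.
  have Ap : psd_form A by rewrite AU; exact: from_spectrum_psd.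
  have pA := random_pivots_law Ap law; have [ms _] := law.
  rewrite (retr_sub_truncation UU AU BU).
  have resE w : A - rpcholesky A s k w = residual A (history s k w).
    exact: sub_pivoted_cholesky.
  split=> hk.
    rewrite unlock; under eq_integral do rewrite resE.
    rewrite (integral_history P ms (g := fun h => retr (residual A h))) //.
      by rewrite lee_fin; exact: (mean_trace_approx pA UU AU lam0 mono r1 eps01 hk).
    by move=> h; apply/retr_ge0/residual_psd.
  under eq_set do rewrite resE.
  rewrite (prob_history P ms
    (fun h => (1 + eps) * tail_sum lam r < retr (residual A h))) //.
  by rewrite lee_fin; exact: (failure_mass_le pA UU AU lam0 mono r1 eps01 delta01 hk).
- by move=> r eps delta; exact: k_hp_le.
- exact: k_hp_asymptotics.
Qed.
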